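(* Let $(M,\tau,\ell)$ be a Polish metric spacetime such that $\ell$ is Borel, and let $0\ne q\le1$. Then $(\mathscr P(M),\ell_q)$ equipped with the narrow topology is a Polish metric spacetime as well.
   Context: A time separation on a set $X$ is a map $\ell:X\times X\to\{-\infty\}\cup[0,+\infty]$ with $\ell(x,x)=0$ and $\min\{\ell(x,y)+\ell(y,z),\ell(y,z)+\ell(x,y)\}\le\ell(x,z)$ for all $x,y,z$, where $\pm\infty+z=\pm\infty$ for every $z\in[-\infty,\infty]$; write $x\le y$ if $\ell(x,y)\ge0$. A Polish metric spacetime $(X,\tau,\ell)$ is a set with a Polish topology $\tau$ and a time separation $\ell$ such that $\le$ is a partial order and $\{\ell\ge0\}$ is closed in $X^2$. For $0\ne q\le1$: $u_q(z)=z^q/q$ for $z\in(0,\infty)$, $u_q=-\infty$ on $[-\infty,0)$, $u_q(0)=-\infty$ if $q<0$ and $0$ if $q>0$, $u_q(+\infty)=0$ if $q<0$ and $+\infty$ if $q>0$. $\mathscr P(M)$ is the set of Borel probability measures on $M$. $\Pi_\le(\mu,\nu)$ is the set of couplings of $\mu$ and $\nu$ concentrated on $\{\ell\ge0\}$. $\ell_q(\mu,\nu):=-\infty$ if $\Pi_\le(\mu,\nu)=\emptyset$, otherwise $\ell_q(\mu,\nu)\in[0,+\infty]$ is the element with $u_q(\ell_q(\mu,\nu))=\sup_{\pi\in\Pi_\le(\mu,\nu)}\int_{M\times M}u_q\circ\ell\,\mathrm d\pi$. *)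

(* Defs.v *)
From HB Require Import structures.
From mathcomp Require Import all_boot all_order all_algebra.
From mathcomp Require Import all_classical all_reals all_analysis.
From mathcomp Require Import measurable_realfun.
Set Implicit Arguments.
Unset Strict Implicit.
Unset Printing Implicit Defensive.
Import Order.TTheory GRing.Theory Num.Theory.
Import numFieldNormedType.Exports.
Local Open Scope classical_set_scope.
Local Open Scope ring_scope.

Section PolishMetricSpacetime.
Context {R : realType}.

Definition is_distance (X : Type) (d : X -> X -> R) : Prop :=
  [/\ forall x, d x x = 0,
      forall x y, d x y = 0 -> x = y,
      forall x y, d x y = d y x
    & forall y x z, d x z <= d x y + d y z].

Definition induces_topology (X : topologicalType) (d : X -> X -> R) : Prop :=
  forall (x : X) (A : set X),
    nbhs x A <-> exists2 e : R, 0 < e & [set y | d x y < e] `<=` A.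

Definition complete_distance (X : topologicalType) (d : X -> X -> R) : Prop :=
  forall u : nat -> X,
    (forall e : R, 0 < e -> exists N, forall m n,
       (N <= m)%N -> (N <= n)%N -> d (u m) (u n) < e) ->
    exists x : X, u @ \oo --> x.

Definition separable (X : topologicalType) : Prop :=
  exists2 D : set X, countable D & dense D.

Definition polish (X : topologicalType) : Prop :=
  separable X /\
  exists d : X -> X -> R,
    [/\ is_distance d, induces_topology d & complete_distance d].

(* Addition on [-oo, +oo] in which an infinite left summand absorbs the right
   one, so (+oo) + (-oo) = +oo and (-oo) + (+oo) = -oo; the library's addition
   is instead commutative, with -oo absorbing. *)
Definition absorb_add (x y : \bar R) : \bar R :=
  match x with
  | r%:E => (r%:E + y)%E
  | +oo%E => +oo%E
  | -oo%E => -oo%E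
  end.

Definition time_separation (X : Type) (l : X -> X -> \bar R) : Prop :=
  [/\ forall x y, l x y = -oo%E \/ (0 <= l x y)%E,
      forall x, l x x = 0%E
    & forall x y z,
        (Order.min (absorb_add (l x y) (l y z)) (absorb_add (l y z) (l x y))
           <= l x z)%E].

Definition causal (X : Type) (l : X -> X -> \bar R) (x y : X) : Prop :=
  (0 <= l x y)%E.

Definition causal_set (X : Type) (l : X -> X -> \bar R) : set (X * X) :=
  [set p | causal l p.1 p.2].

Definition partial_order (X : Type) (r : X -> X -> Prop) : Prop :=
  [/\ forall x, r x x,
      forall x y z, r x y -> r y z -> r x z
    & forall x y, r x y -> r y x -> x = y].

Definition polish_metric_spacetime (X : ptopologicalType)
    (l : X -> X -> \bar R) : Prop :=
  [/\ polish X, time_separation l, partial_order (causal l)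
    & closed (causal_set l)].

End PolishMetricSpacetime.

HB.instance Definition _ (X Y : ptopologicalType) := Pointed.on (X * Y)%type.

Notation borel X := (g_sigma_algebraType (@open X)).

(* A library measure is a function on all subsets, unconstrained off the
   sigma-algebra. The condition [bprob0] selects exactly one representative of
   each Borel probability measure, so that Leibniz equality on [bprob] is
   equality of measures. *)
Record bprob (R : realType) (X : ptopologicalType) := BProb {
  bprob_val :> probability (borel X) R;
  bprob0 : forall A : set (borel X), ~ measurable A -> bprob_val A = 0%E }.

Lemma bprob_ext (R : realType) (X : ptopologicalType) (mu nu : bprob R X) :
  (forall A : set (borel X), measurable A -> mu A = nu A) -> mu = nu.
Proof.
move=> e; have {e} : mu = nu :> (set (borel X) -> \bar R).
  apply/funext => A; have [/e//|nA] := pselect (measurable A).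
  by rewrite !bprob0.
case: mu nu => [mu mu0] [nu nu0] /= e.
have E : mu = nu.
  case: mu nu e {mu0 nu0} => [mu [a b c e f g h]] [nu [a' b' c' e' f' g' h']].
  move=> /= E; subst nu; congr Probability.Pack.
  case: a b c e f g h => a1 a2 [b] [c] [e] [f] [g] [h].
  case: a' b' c' e' f' g' h' => a1' a2' [b'] [c'] [e'] [f'] [g'] [h'].
  rewrite (Prop_irrelevance a1' a1) (Prop_irrelevance a2' a2).
  rewrite (Prop_irrelevance b' b) (Prop_irrelevance c' c).
  rewrite (Prop_irrelevance e' e) (Prop_irrelevance f' f).
  by rewrite (Prop_irrelevance g' g) (Prop_irrelevance h' h).
subst nu; congr BProb; exact: Prop_irrelevance.
Qed.

Section BorelNormalization.
Context {R : realType} {X : ptopologicalType}.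
Variable mu : probability (borel X) R.

Definition mborel (A : set (borel X)) : \bar R :=
  if `[< measurable A >] then mu A else 0%E.

Lemma mborelE (A : set (borel X)) : measurable A -> mborel A = mu A.
Proof. by move=> mA; rewrite /mborel; case: asboolP. Qed.

Let mborel_set0 : mborel set0 = 0%E.
Proof. by rewrite mborelE// measure0. Qed.

Let mborel_ge0 A : (0 <= mborel A)%E.
Proof. by rewrite /mborel; case: ifP. Qed.

Let mborel_sigma_additive : semi_sigma_additive mborel.
Proof.
move=> F mF tF mUF; rewrite mborelE//.
under eq_fun do under eq_bigr do rewrite mborelE//.
exact: measure_semi_sigma_additive.
Qed.

HB.instance Definition _ :=
  isMeasure.Build _ _ _ mborel mborel_set0 mborel_ge0 mborel_sigma_additive.

Let mborel_setT : mborel setT = 1%E.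
Proof. by rewrite mborelE// probability_setT. Qed.

HB.instance Definition _ := Measure_isProbability.Build _ _ _ mborel mborel_setT.

Lemma mborel_out (A : set (borel X)) : ~ measurable A -> mborel A = 0%E.
Proof. by move=> nA; rewrite /mborel; case: asboolP. Qed.

Definition to_bprob : bprob R X := BProb mborel_out.

Lemma to_bprobE (A : set (borel X)) : measurable A -> to_bprob A = mu A.
Proof. exact: mborelE. Qed.

End BorelNormalization.

Section NarrowTopology.
Context (R : realType) (X : ptopologicalType).

HB.instance Definition _ := gen_eqMixin (bprob R X).
HB.instance Definition _ := gen_choiceMixin (bprob R X).
HB.instance Definition _ := isPointed.Build (bprob R X)
  (to_bprob (\d_(point : borel X) : probability (borel X) R)).

Definition Cb : Type :=
  {f : X -> R | continuous f /\ exists K : R, forall x, `|f x| <= K}.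

Definition narrow_eval (mu : bprob R X) : {ptws Cb -> R} :=
  fun f => Rintegral mu [set: borel X] (sval f).

HB.instance Definition _ :=
  Topological.copy (bprob R X) (initial_topology narrow_eval).

End NarrowTopology.

Section LorentzWasserstein.
Context {R : realType}.

Definition utility (q : R) (z : \bar R) : \bar R :=
  match z with
  | r%:E => if 0 < r then (r `^ q / q)%:E
            else if r == 0 then (if 0 < q then 0%E else -oo%E)
            else -oo%E
  | +oo%E => if 0 < q then +oo%E else 0%E
  | -oo%E => -oo%E
  end.

Context {M : ptopologicalType}.

Definition borel_separation (l : M -> M -> \bar R) : Prop :=
  measurable_fun [set: borel (M * M)%type]
    ((fun p => l p.1 p.2) : borel (M * M)%type -> \bar R).

Definition coupling (mu nu : bprob R M) : set (bprob R (M * M)%type) :=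
  [set pi | forall A : set (borel M), measurable A ->
     pi (fst @^-1` A) = mu A /\ pi (snd @^-1` A) = nu A].

Definition causal_coupling (l : M -> M -> \bar R) (mu nu : bprob R M) :
    set (bprob R (M * M)%type) :=
  [set pi | coupling mu nu pi /\ pi (causal_set l) = 1%E].

Definition transport_value (l : M -> M -> \bar R) (q : R) (mu nu : bprob R M) :
    \bar R :=
  ereal_sup [set (\int[pi]_(p in [set: borel (M * M)%type])
                    utility q (l p.1 p.2))%E | pi in causal_coupling l mu nu].

Lemma utility_onto (q : R) (v : \bar R) : q != 0 ->
  (if 0 < q then (0 <= v)%E else (v <= 0)%E) ->
  exists t, (0 <= t)%E /\ utility q t = v.
Proof.
move=> q0; case: ltP => [q_gt0|q_le0].
  case: v => [r| |]//=; last by move=> _; exists +oo%E => /=; rewrite q_gt0.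
  rewrite lee_fin le_eqVlt => /predU1P[<-|r0].
    by exists 0%E; rewrite /= ltxx eqxx q_gt0.
  exists ((r * q) `^ q^-1)%:E; rewrite lee_fin powR_ge0 /=; split=> //.
  have rq : 0 < r * q by rewrite mulr_gt0.
  by rewrite powR_gt0// -powRrM mulVf// powRr1 ?ltW// mulfK.
have {q_le0} q_lt0 : q < 0 by rewrite lt_neqAle q0.
have q_gt0F : (0 < q) = false by rewrite ltNge ltW.
case: v => [r| |]//=; last first.
  by move=> _; exists 0%E; rewrite /= ltxx eqxx q_gt0F.
rewrite lee_fin le_eqVlt => /predU1P[->|r0].
  by exists +oo%E; rewrite /= q_gt0F leey.
exists ((r * q) `^ q^-1)%:E; rewrite lee_fin powR_ge0 /=; split=> //.
have rq : 0 < r * q by rewrite nmulr_rgt0.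
by rewrite powR_gt0// -powRrM mulVf// powRr1 ?ltW// mulfK.
Qed.

Lemma utility_inj (q : R) (s t : \bar R) : q != 0 ->
  (0 <= s)%E -> (0 <= t)%E -> utility q s = utility q t -> s = t.
Proof.
move=> q0.
have aux (x y : R) : 0 < x -> 0 < y -> x `^ q / q = y `^ q / q -> x = y.
  move=> x0 y0 /(congr1 ( *%R^~ q)); rewrite !mulfVK// => e.
  have := congr1 (@powR R ^~ q^-1) e.
  by rewrite -!powRrM mulfV// !powRr1 ?ltW.
have nz (x : R) : 0 < x -> x `^ q / q <> 0.
  by move=> x0 /eqP; rewrite mulf_eq0 invr_eq0 (negbTE q0) orbF gt_eqF// powR_gt0.
case: s => [s| |]//; case: t => [t| |]//; rewrite ?lee_fin /=.
- rewrite !le_eqVlt => /predU1P[<-|s0] /predU1P[<-|t0] //.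
  + rewrite ltxx eqxx t0; case: ifP => // _ [] /esym h; by case: (nz _ t0).
  + rewrite ltxx eqxx s0; case: ifP => // _ [] h; by case: (nz _ s0).
  + by rewrite s0 t0 => -[] /(aux _ _ s0 t0) ->.
- rewrite le_eqVlt => /predU1P[<-|s0] _.
    by rewrite ltxx eqxx; case: ifP.
  by rewrite s0; case: ifP => // _ [] /(nz _ s0).
- move=> _; rewrite le_eqVlt => /predU1P[<-|s0].
    by rewrite ltxx eqxx; case: ifP.
  by rewrite s0; case: ifP => // _ [] /esym /(nz _ s0).
Qed.

(* When causal couplings exist, the supremum is nonnegative for q > 0 and
   nonpositive for q < 0, so by [utility_onto] and [utility_inj] exactly one t
   qualifies and the default value of [xget] is not used. *)
Definition ell (l : M -> M -> \bar R) (q : R) (mu nu : bprob R M) : \bar R :=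
  if `[< causal_coupling l mu nu = set0 >] then -oo%E
  else xget -oo%E
         [set t | (0 <= t)%E /\ utility q t = transport_value l q mu nu].


End LorentzWasserstein.

(* Main.v *)
Require Import Defs.
From HB Require Import structures.
From mathcomp Require Import all_boot all_order all_algebra.
From mathcomp Require Import all_classical all_reals all_analysis.
From mathcomp Require Import measurable_realfun.
From mathcomp Require Import ring lra.
Set Implicit Arguments.
Unset Strict Implicit.
Unset Printing Implicit Defensive.
Import Order.TTheory GRing.Theory Num.Theory.
Import numFieldNormedType.Exports.
Local Open Scope classical_set_scope.
Local Open Scope ring_scope.

(* The narrow topology on probability measures is metrized by the
   bounded-Lipschitz distance. A Cauchy sequence for it is tight, so by Prokhorov's
   theorem (the limit of integrals along an ultrafilter is a functional represented
   by an outer measure) it converges. Since couplings of tight families are tight,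
   limits of causal couplings exist, and they are causal because the causal relation
   is closed; hence the relation "some causal coupling exists" is closed.

   Antisymmetry and the vanishing of the separation on the diagonal come from the
   closed upper sets of compact sets, which nearly separate points: measures related
   in both directions agree on them, which forces a causal coupling to live on the
   diagonal. For the triangle inequality two causal couplings are glued, and the
   reverse Minkowski inequality follows from the supporting plane
   c1 u(x) + c2 u(y) <= u(x + y) at the two separations involved. *)

(** * Distances and bump functions *)

(** Ultrafilters replace subsequences: along one, the expectations of all bounded continuous
    functions converge at once, and a cluster point in a compact set is a limit. Bumps are the test
    functions throughout: they decrease to indicators of closed sets, hence determine measures, and
    being multiples of 1-Lipschitz functions they are controlled by the bounded-Lipschitz distance.
    Since [l] is only Borel, the integral of the utility need not be semicontinuous in the coupling
    and the supremum need not be attained. Closedness therefore concerns only the existence of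
    causal couplings, and the triangle inequality is proved with nearly optimal ones. A supporting
    plane suits this: being linear, it can be integrated along a glued coupling, and its
    coefficients depend only on the two separations, not on the couplings. Separations equal to 0 or
    +oo are treated by monotonicity instead. *)

Section Distance.
Context {R : realType} {X : ptopologicalType} (d : X -> X -> R).
Hypotheses (dd : is_distance d) (dt : induces_topology d).

Lemma distxx x : d x x = 0. Proof. by case: dd. Qed.
Lemma dist0_eq x y : d x y = 0 -> x = y. Proof. by case: dd => _ + _ _; exact. Qed.
Lemma distC x y : d x y = d y x. Proof. by case: dd. Qed.
Lemma dist_tri y x z : d x z <= d x y + d y z. Proof. by case: dd. Qed.

Lemma dist_ge0 x y : 0 <= d x y.
Proof. by have := dist_tri y x x; rewrite distxx (distC y x); lra. Qed.

Lemma nbhs_dist (x : X) e : 0 < e -> nbhs x [set y | d x y < e].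
Proof. by move=> e0; apply/dt; exists e. Qed.

Lemma open_dist (A : set X) :
  open A <-> forall x, A x -> exists2 e, 0 < e & [set y | d x y < e] `<=` A.
Proof.
rewrite openE; split=> [h x /h|h x /h]; first by rewrite /interior/= => /dt.
by move=> /dt.
Qed.

Lemma closed_dist (A : set X) : closed A -> forall x, ~ A x ->
  exists2 e, 0 < e & forall y, A y -> e <= d x y.
Proof.
rewrite -openC => /open_dist + x nAx => /(_ x nAx)[e e0 eA].
by exists e => // y Ay; rewrite leNgt; apply/negP => /eA.
Qed.

Lemma lip_continuous (f : X -> R) K :
  (forall x y, `|f x - f y| <= K * d x y) -> continuous f.
Proof.
move=> fK x; apply/cvgrPdist_lt => e e0; near=> y.
(* [K] is not assumed positive, so the modulus of continuity uses the absolute value of [K] plus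
   1. *)
have K1 : 0 < `|K| + 1 by rewrite ltr_wpDl.
rewrite (le_lt_trans (fK x y))// (@le_lt_trans _ _ ((`|K| + 1) * d x y))//.
  by rewrite ler_wpM2r ?dist_ge0// (le_trans (ler_norm K))// lerDl.
rewrite mulrC -ltr_pdivlMr//.
by near: y; apply: nbhs_dist; rewrite divr_gt0.
Unshelve. all: by end_near. Qed.

Lemma distr_continuous x : continuous (d x).
Proof.
apply: (@lip_continuous _ 1) => y z; rewrite mul1r ler_norml.
have := dist_tri y x z; have := dist_tri z x y; rewrite (distC z y).
by move=> *; apply/andP; split; lra.
Qed.

(* The member 0 gives the supremum its natural value when C is empty. *)
Definition bump (k : R) (C : set X) (x : X) : R :=
  sup ([set 0] `|` [set Num.max 0 (1 - k * d x y) | y in C]).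

Section Bump.
Variables (k : R) (C : set X).
Hypothesis k0 : 0 <= k.

Let S x := [set 0] `|` [set Num.max 0 (1 - k * d x y) | y in C].

Let S0 x : S x !=set0. Proof. by exists 0; left. Qed.

Let S1 x : ubound (S x) 1.
Proof.
move=> _ [->//|[y _ <-]]; rewrite ge_max ler01/= gerBl.
by rewrite mulr_ge0 ?dist_ge0.
Qed.

Lemma bump_ge0 x : 0 <= bump k C x.
Proof. by apply: ub_le_sup; [exists 1; exact: S1|left]. Qed.

Lemma bump_le1 x : bump k C x <= 1.
Proof. by apply: ge_sup; [exact: S0|exact: S1]. Qed.

Lemma bump_lb x y : C y -> 1 - k * d x y <= bump k C x.
Proof.
move=> Cy; apply: (@le_trans _ _ (Num.max 0 (1 - k * d x y))).
  by rewrite le_max lexx orbT.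
by apply: ub_le_sup; [exists 1; exact: S1|right; exists y].
Qed.

Lemma bump_ub x r : 0 <= r -> (forall y, C y -> 1 - k * d x y <= r) ->
  bump k C x <= r.
Proof.
move=> r0 h; apply: ge_sup; first exact: S0.
by move=> _ [->//|[y Cy <-]]; rewrite ge_max r0 h.
Qed.

Lemma bump_eq1 x : C x -> bump k C x = 1.
Proof.
move=> Cx; apply/eqP; rewrite eq_le bump_le1/=.
by have := bump_lb x Cx; rewrite distxx mulr0 subr0.
Qed.

Lemma bump_eq0 x : (forall y, C y -> 1 <= k * d x y) -> bump k C x = 0.
Proof.
move=> h; apply/eqP; rewrite eq_le bump_ge0 andbT.
by apply: bump_ub => // y /h; lra.
Qed.

Lemma bump_lip x y : `|bump k C x - bump k C y| <= k * d x y.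
Proof.
suff h a b : bump k C a <= bump k C b + k * d a b.
  by rewrite ler_norml; have := h x y; have := h y x; rewrite (distC y x) => *;
  apply/andP; split; lra.
apply: bump_ub => [|z Cz]; first by rewrite addr_ge0 ?bump_ge0// mulr_ge0 ?dist_ge0.
have := bump_lb b Cz; have := ler_wpM2l k0 (dist_tri a b z).
by rewrite mulrDr (distC b a); lra.
Qed.

Lemma bump_continuous : continuous (bump k C).
Proof. exact: lip_continuous bump_lip. Qed.

Lemma bump_pos x : 0 < bump k C x -> exists2 y, C y & k * d x y < 1.
Proof.
move=> h; apply: contrapT => nh; move: h; rewrite bump_eq0 ?ltxx// => y Cy.
by rewrite leNgt; apply/negP => ?; apply: nh; exists y.
Qed.

End Bump.

(** Off [C] the distance to [C] is at least some [e > 0], and the bump vanishes as soon as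
    [n >= e^-1]; the sequence is eventually constant at every point. *)
Lemma bump_closed_cvg (C : set X) x : closed C ->
  bump n%:R C x @[n --> \oo] --> (\1_C x : R).
Proof.
move=> cC; have [Cx|nCx] := pselect (C x).
  rewrite indicE mem_set//; apply: cvg_near_cst; near=> n.
  by rewrite bump_eq1.
rewrite indicE memNset//; have [e e0 he] := closed_dist cC nCx.
apply: cvg_near_cst; near=> n; rewrite bump_eq0// => y /he h.
have : e^-1 <= n%:R by near: n; exact: nbhs_infty_ger.
move=> /(ler_pM _ _)/(_ h); rewrite mulVf ?gt_eqF//; apply => //.
- by rewrite invr_ge0 ltW.
- exact: ltW.
Unshelve. all: by end_near. Qed.

End Distance.

(** * Expectations of bounded functions *)

Section Expectation.
Context {dsp : measure_display} {T : measurableType dsp} {R : realType}.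
Implicit Types (P : probability T R) (f g : T -> R).

(** Such functions are integrable for every probability measure, so linearity and monotonicity of
    [Ex] need no further side conditions. *)
Definition bmeas (f : T -> R) : Prop :=
  measurable_fun [set: T] f /\ exists K : R, forall x, `|f x| <= K.

Lemma bmeas_integrable P f : bmeas f -> P.-integrable [set: T] (EFin \o f).
Proof.
move=> [mf [K fK]]; apply: measurable_bounded_integrable => //.
  by rewrite [X in (X < _)%E](@probability_setT _ _ _ P) ltry.
exists K; split; first by rewrite num_real.
by move=> M KM x _ /=; rewrite (le_trans (fK x))// ltW.
Qed.

Lemma bmeas_cst c : bmeas (cst c).
Proof. by split=> //; exists `|c|. Qed.

Lemma bmeasD f g : bmeas f -> bmeas g -> bmeas (fun x => f x + g x).
Proof.
move=> [mf [K fK]] [mg [L gL]]; split; first exact: measurable_funD.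
by exists (K + L) => x; rewrite (le_trans (ler_normD _ _))// lerD.
Qed.

Lemma bmeasZ c f : bmeas f -> bmeas (fun x => c * f x).
Proof.
move=> [mf [K fK]]; split; first exact: measurable_funM.
by exists (`|c| * K) => x; rewrite normrM ler_wpM2l.
Qed.

Lemma bmeasN f : bmeas f -> bmeas (fun x => - f x).
Proof.
by move=> /(bmeasZ (-1)); under eq_fun do rewrite mulN1r.
Qed.

Lemma bmeasB f g : bmeas f -> bmeas g -> bmeas (fun x => f x - g x).
Proof. by move=> bf /bmeasN; exact: bmeasD. Qed.

Lemma bmeas_indic (A : set T) : measurable A -> bmeas (\1_A : T -> R).
Proof.
move=> mA; split; first exact: measurable_indic.
by exists 1 => x; rewrite indicE ger0_norm// lern1; case: (_ \in _).
Qed.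

Lemma bmeas_sum n (F : nat -> T -> R) : (forall i, (i < n)%N -> bmeas (F i)) ->
  bmeas (fun x => \sum_(i < n) F i x).
Proof.
elim: n => [|n ih] h; first by under eq_fun do rewrite big_ord0; exact: bmeas_cst.
under eq_fun do rewrite big_ord_recr/=; apply: bmeasD; last exact: h.
by apply: ih => i /ltnW; exact: h.
Qed.

Definition Ex P f : R := Rintegral P [set: T] f.

Lemma ExE P f : bmeas f -> (Ex P f)%:E = (\int[P]_x (f x)%:E)%E.
Proof.
move=> bf; rewrite /Ex /Rintegral fineK//.
exact: (integrable_fin_num measurableT (bmeas_integrable P bf)).
Qed.

Lemma Ex_cst P c : Ex P (cst c) = c.
Proof.
by rewrite /Ex Rintegral_cst// [X in fine X](@probability_setT _ _ _ P) mulr1.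
Qed.

Lemma ExD P f g : bmeas f -> bmeas g ->
  Ex P (fun x => f x + g x) = Ex P f + Ex P g.
Proof. by move=> bf bg; apply: RintegralD => //; exact: bmeas_integrable. Qed.

Lemma ExB P f g : bmeas f -> bmeas g ->
  Ex P (fun x => f x - g x) = Ex P f - Ex P g.
Proof. by move=> bf bg; apply: RintegralB => //; exact: bmeas_integrable. Qed.

Lemma ExZ P c f : bmeas f -> Ex P (fun x => c * f x) = c * Ex P f.
Proof. by move=> bf; apply: RintegralZl => //; exact: bmeas_integrable. Qed.

Lemma Ex_sum P n (F : nat -> T -> R) : (forall i, (i < n)%N -> bmeas (F i)) ->
  Ex P (fun x => \sum_(i < n) F i x) = \sum_(i < n) Ex P (F i).
Proof.
elim: n => [|n ih] h.
  by under eq_fun do rewrite big_ord0; rewrite big_ord0; exact: (Ex_cst P 0).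
under eq_fun do rewrite big_ord_recr/=; rewrite ExD; last exact: h.
  by rewrite big_ord_recr/= ih// => i /ltnW; exact: h.
by apply: (@bmeas_sum n F) => i /ltnW; exact: h.
Qed.

Lemma le_Ex P f g : bmeas f -> bmeas g -> (forall x, f x <= g x) ->
  Ex P f <= Ex P g.
Proof.
by move=> bf bg fg; apply: le_Rintegral => //; exact: bmeas_integrable.
Qed.

Lemma normr_Ex_le P f K : bmeas f -> (forall x, `|f x| <= K) -> `|Ex P f| <= K.
Proof.
move=> bf fK; have h x : - K <= f x <= K by rewrite -ler_norml.
rewrite ler_norml; apply/andP; split.
  rewrite -[leLHS](Ex_cst P); apply: le_Ex => // [|x]; first exact: bmeas_cst.
  by case/andP: (h x).
rewrite -[leRHS](Ex_cst P); apply: le_Ex => // [|x]; first exact: bmeas_cst.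
by case/andP: (h x).
Qed.

Lemma Ex_indic P (A : set T) : measurable A -> (Ex P \1_A)%:E = P A.
Proof.
move=> mA; rewrite ExE; last exact: bmeas_indic.
by rewrite integral_indic// setIT.
Qed.

(** Through [le_Ex], inequalities between masses of sets become pointwise inequalities between
    indicators. *)
Lemma fine_Ex P (A : set T) : measurable A -> fine (P A) = Ex P \1_A.
Proof. by move=> mA; rewrite -Ex_indic. Qed.

Lemma Ex_cvg P (F : nat -> T -> R) f K : (forall n, bmeas (F n)) ->
  (forall n x, `|F n x| <= K) -> (forall x, F n x @[n --> \oo] --> f x) ->
  Ex P (F n) @[n --> \oo] --> Ex P f.
Proof.
move=> bF FK Ff.
have fK x : `|f x| <= K.
  apply: (@closed_cvg _ _ _ _ (fun n => F n x) (fun y => `|y| <= K)) (Ff x) => //.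
    by apply: closed_comp (@closed_le _ K) => y _; exact: norm_continuous.
  by apply: nearW => n; exact: FK.
have mf : measurable_fun [set: T] f.
  by apply: (measurable_fun_cvg (h := F)) => // n; case: (bF n).
have bf : bmeas f by split=> //; exists K.
have iK : P.-integrable [set: T] (EFin \o cst K).
  exact: bmeas_integrable (bmeas_cst K).
have [||||_ _] := @dominated_convergence _ _ _ P _ measurableT
  (fun n => EFin \o F n) (EFin \o f) (EFin \o cst K) _ _ _ iK.
- by move=> n; apply/measurable_EFinP; case: (bF n).
- exact/measurable_EFinP.
- by apply: aeW => x _; apply: cvg_EFin; [exact: nearW|exact: Ff].
- by apply: aeW => x n _; rewrite lee_fin.
move=> h; rewrite /Ex /Rintegral; apply: fine_cvg; rewrite fineK//.
exact: (integrable_fin_num measurableT (bmeas_integrable P bf)).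
Qed.

End Expectation.

(** * Borel sets, and measures determined by closed sets *)

Section Borel.
Context {R : realType} {X Y : ptopologicalType}.

Lemma open_borel (A : set X) : open A -> measurable (A : set (borel X)).
Proof. by move=> oA; exact: sub_sigma_algebra. Qed.

Lemma closed_borel (A : set X) : closed A -> measurable (A : set (borel X)).
Proof. move=> cA; rewrite -[A]setCK; apply: (@measurableC _ (borel X)).
by apply: open_borel; exact: closed_openC. Qed.

Lemma continuous_borel (f : X -> Y) : continuous f ->
  measurable_fun [set: borel X] (f : borel X -> borel Y).
Proof.
move=> cf; apply: (@measurability _ _ (borel X) (borel Y) _ _ (@open Y)) => // _ [A oA <-].
by rewrite setTI; apply: open_borel; move/continuousP : cf; exact.
Qed.

Lemma continuous_real_borel (f : X -> R) : continuous f ->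
  measurable_fun [set: borel X] (f : borel X -> R).
Proof.
move=> cf; apply: (@measurability _ _ _ _ _ _ (@RGenOpens.G R)); first exact: RGenOpens.measurableE.
move=> _ [_ [a [b ->]] <-]; rewrite setTI; apply: open_borel.
by move/continuousP : cf; apply; exact: interval_open.
Qed.

Lemma continuous_bmeas (f : X -> R) K : continuous f -> (forall x, `|f x| <= K) ->
  bmeas (f : borel X -> R).
Proof. by move=> cf fK; split; [exact: continuous_real_borel|exists K]. Qed.

End Borel.

Section ClosedDetermine.
Context {R : realType} {X : ptopologicalType} (d : X -> X -> R).
Hypotheses (dd : is_distance d) (dt : induces_topology d).

Lemma bump_bmeas k C : 0 <= k -> bmeas (bump d k C : borel X -> R).
Proof.
move=> k0; apply: (@continuous_bmeas _ _ _ 1); first exact: (bump_continuous dd dt).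
by move=> x; rewrite ger0_norm ?bump_ge0 ?bump_le1.
Qed.

Lemma Ex_bump_cvg (P : probability (borel X) R) (C : set X) : closed C ->
  Ex P (bump d n%:R C) @[n --> \oo] --> fine (P C).
Proof.
move=> cC; have -> : fine (P C) = Ex P \1_C.
  by rewrite -[RHS]/(fine (Ex P \1_C)%:E) Ex_indic//; exact: closed_borel.
apply: (@Ex_cvg _ _ _ _ _ _ 1) => [n|n x|x].
- exact: bump_bmeas.
- by rewrite ger0_norm ?bump_ge0 ?bump_le1.
- exact: bump_closed_cvg.
Qed.

(** Closed sets are stable under intersection and generate the Borel sets, so the uniqueness theorem
    for measures applies. *)
Lemma bprob_closed_eq (mu nu : bprob R X) :
  (forall C : set X, closed C -> mu C = nu C) -> mu = nu.
Proof.
move=> h; apply: bprob_ext => A mA.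
apply: (@measure_unique _ R (borel X) (@closed X) (fun=> setT)) => //.
- rewrite [LHS]/measurable/=; apply/seteqP; split.
    apply: smallest_sub; first exact: smallest_sigma_algebra.
    move=> U oU; rewrite -[U]setCK.
    have /= := @measurableC _ (g_sigma_algebraType (@closed X)) (~` U).
    by apply; apply: sub_sigma_algebra; exact: open_closedC.
  apply: smallest_sub; first exact: smallest_sigma_algebra.
  by move=> C; exact: closed_borel.
- by move=> C D; exact: closedI.
- by apply: bigcup_const; exists 0%N.
- by move=> _; rewrite [X in (X < _)%E](@probability_setT _ _ _ mu) ltry.
Qed.

Lemma bprob_cb_eq (mu nu : bprob R X) :
  (forall (k : R) (C : set X), 0 <= k -> Ex mu (bump d k C) = Ex nu (bump d k C)) ->
  mu = nu.
Proof.
move=> h; apply: bprob_closed_eq => C cC.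
have mC := closed_borel cC.
rewrite -[LHS]fineK ?fin_num_measure// -[RHS]fineK ?fin_num_measure//; congr EFin.
have nC := Ex_bump_cvg (P := nu) cC; have := Ex_bump_cvg (P := mu) cC.
by under eq_fun do rewrite h//; move=> /cvg_unique; apply => //; exact: Rhausdorff.
Qed.

End ClosedDetermine.

(** * Narrow convergence *)

Section RealLimits.
Context {R : realType}.

Lemma cvg_ge_near (I : Type) (F : set_system I) (f : I -> R) (l c : R) :
  ProperFilter F -> f i @[i --> F] --> l -> (\forall i \near F, c <= f i) -> c <= l.
Proof. by move=> FF fl h; exact: (@closed_cvg _ _ F _ f (fun y => c <= y) (@closed_ge _ c) h _ fl). Qed.

Lemma cvg_le_near (I : Type) (F : set_system I) (f : I -> R) (l c : R) :
  ProperFilter F -> f i @[i --> F] --> l -> (\forall i \near F, f i <= c) -> l <= c.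
Proof. by move=> FF fl h; exact: (@closed_cvg _ _ F _ f (fun y => y <= c) (@closed_le _ c) h _ fl). Qed.

End RealLimits.

Section PointwiseTopology.
Context {U : Type} {V : topologicalType}.

(** The topology is a supremum over the evaluations. Each evaluation is onto, constant functions
    attaining every value, so [cvg_image] describes convergence for it. *)
Lemma ptws_cvgP (F : set_system {ptws U -> V}) (f : {ptws U -> V}) : Filter F ->
  F --> f <-> forall t, (fun g : {ptws U -> V} => g t) @ F --> f t.
Proof.
move=> FF; rewrite cvg_sup; split=> h t; have := h t.
  rewrite cvg_image; last by rewrite eqEsubset; split=> v // _; exists (cst v).
  apply: cvg_trans => W /=; rewrite ?nbhs_simpl /fmap /= => [[W' + <-]].
  by apply: filterS => g W'g /=; exists g.
rewrite cvg_image; last by rewrite eqEsubset; split=> v // _; exists (cst v).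
move=> + W //=; rewrite ?nbhs_simpl => Q => /Q Q'; exists (@^~ t @^-1` W) => //.
by rewrite eqEsubset; split => [j [? + <-//]|j Wj]; exists (fun _ => j).
Qed.

End PointwiseTopology.

Section Narrow.
Context {R : realType} {X : ptopologicalType}.
Implicit Types (f : X -> R) (mu : bprob R X).

Definition cb f : Prop := continuous f /\ exists K : R, forall x, `|f x| <= K.

Lemma cb_bmeas f : cb f -> bmeas (f : borel X -> R).
Proof. by move=> [cf [K fK]]; exact: continuous_bmeas cf fK. Qed.

Lemma cbD f g : cb f -> cb g -> cb (fun x => f x + g x).
Proof.
move=> [cf [K fK]] [cg [L gL]]; split; first by move=> x; exact: cvgD (cf x) (cg x).
by exists (K + L) => x; rewrite (le_trans (ler_normD _ _))// lerD.
Qed.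

Lemma cbZ c f : cb f -> cb (fun x => c * f x).
Proof.
move=> [cf [K fK]]; split; first by move=> x; exact: cvgM (cvg_cst c) (cf x).
by exists (`|c| * K) => x; rewrite normrM ler_wpM2l.
Qed.

Lemma cb_cst c : cb (cst c).
Proof. by split; [move=> x; exact: cvg_cst|exists `|c|]. Qed.

Lemma cbB f g : cb f -> cb g -> cb (fun x => f x - g x).
Proof.
move=> cf cg; have := cbD cf (cbZ (-1) cg).
by under eq_fun do rewrite mulN1r.
Qed.

Lemma narrow_cvgP (I : Type) (F : set_system I) (u : I -> bprob R X) mu :
  Filter F ->
  (u @ F --> mu) <-> (forall f, cb f -> Ex (u i) f @[i --> F] --> Ex mu f).
Proof.
move=> FF; split=> [h f cf|h].
  pose f' : Cb R X := exist _ f cf.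
  have c1 : (narrow_eval (R := R) (X := X)) \o u @ F --> narrow_eval mu.
    apply: cvg_comp h _.
    exact: (@initial_continuous _ _ (@narrow_eval R X)).
  have c2 : forall t : Cb R X, (fun g : {ptws Cb R X -> R} => g t) @
      (narrow_eval (R := R) (X := X) \o u @ F) --> narrow_eval mu t.
    exact: (ptws_cvgP (narrow_eval mu) _).1 c1.
  exact: (c2 f').
move=> A [B []]; case=> O oO <- Omu OB.
have c1 : (narrow_eval (R := R) (X := X)) \o u @ F --> narrow_eval mu.
  by apply/ptws_cvgP => -[f cf]; exact: h.
have : nbhs (narrow_eval mu) O by exact: open_nbhs_nbhs.
move=> /c1 FO; have {}FO : F [set i | O (narrow_eval (u i))] := FO.
by have : F [set i | A (u i)] by apply: filterS FO => i; exact: OB.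
Qed.

End Narrow.

(** * Layer-cake approximation and the portmanteau theorem *)

Section LayerCake.
Context {R : realType}.

Let cnt (n : nat) (y : R) : R := \sum_(k < n) (k.+1%:R < y)%R%:R.

Let cnt_le n y : cnt n y <= n%:R.
Proof.
rewrite /cnt -[leRHS]mulr1 mulr_natl -[n in leRHS]card_ord -sumr_const.
by apply: ler_sum => i _; case: (_ < _).
Qed.

Lemma count_floor_le n (y : R) : 0 <= y -> \sum_(k < n) (k.+1%:R < y)%R%:R <= y.
Proof.
move=> y0; elim: n => [|n ih]; first by rewrite big_ord0.
have := cnt_le n y; rewrite /cnt big_ord_recr/=.
case: ltP => /= h; last by rewrite addr0.
by move=> hn; apply: le_trans (ltW h); rewrite -[leRHS]natr1 lerD2r.
Qed.

Lemma count_floor_ge n (y : R) : y <= n%:R -> y <= 1 + \sum_(k < n) (k.+1%:R < y)%R%:R.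
Proof.
elim: n => [|n ih] yn; first by rewrite big_ord0 addr0 (le_trans yn).
rewrite big_ord_recr/=; have [{}/ih ih|ny] := leP y n%:R.
  by rewrite (le_trans ih)// addrA lerDl; case: (_ < _).
rewrite (eq_bigr (fun=> 1)) => [|i _]; last first.
  by rewrite (le_lt_trans _ ny)// ler_nat.
rewrite sumr_const card_ord (le_trans yn)// -natr1 addrA.
by rewrite natr1 [1 + _]addrC natr1 lerDl; case: (_ < _).
Qed.

End LayerCake.

Section Portmanteau.
Context {R : realType} {X : ptopologicalType}.
Implicit Types (f : X -> R) (mu : bprob R X).

(** The strict inequality makes the layers open; divided by [n], the sum of their indicators is
    within [1 / n] of a function with values in [[0, 1]]. *)
Let lay n f k : set X := [set x | k.+1%:R < n%:R * f x].

Let layf n f x : R := \sum_(k < n) \1_(lay n f k) x.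

Let lay_open n f k : continuous f -> open (lay n f k).
Proof.
move=> cf; have : continuous (fun x => n%:R * f x).
  by move=> x; exact: cvgM (cvg_cst _) (cf x).
by move=> /continuousP/(_ _ (@open_gt _ k.+1%:R)).
Qed.

Let layf_Ex n f (P : probability (borel X) R) : continuous f ->
  Ex P (layf n f) = \sum_(k < n) fine (P (lay n f k)).
Proof.
move=> cf; have mlay k : measurable (lay n f k : set (borel X)).
  by apply: open_borel; exact: lay_open.
rewrite /layf (@Ex_sum _ (borel X) _ P n (fun k => \1_(lay n f k)))//.
  by apply: eq_bigr => k _; rewrite -Ex_indic.
by move=> k _; exact: bmeas_indic.
Qed.

Let layf_bmeas n f : continuous f -> bmeas (layf n f : borel X -> R).
Proof.
move=> cf; apply: (@bmeas_sum _ (borel X) _ n (fun k => \1_(lay n f k))) => k _.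
by apply: bmeas_indic; by apply: open_borel; exact: lay_open.
Qed.

Let layf_le n f x : 0 <= f x -> layf n f x <= n%:R * f x.
Proof.
move=> f0; apply: le_trans (count_floor_le n (mulr_ge0 (ler0n _ n) f0)).
by apply: ler_sum => k _; rewrite indicE mem_setE.
Qed.

Let layf_ge n f x : f x <= 1 -> n%:R * f x <= 1 + layf n f x.
Proof.
move=> f1; have /count_floor_ge/le_trans : n%:R * f x <= n%:R.
  by rewrite ler_piMr.
apply; rewrite lerD2l.
by apply: ler_sum => k _; rewrite indicE mem_setE.
Qed.

(** Only finitely many layers occur, so the hypothesis holds for all of them at once. The layering
    costs [1 / n <= e / 2], and the losses on the [n] layers cost another [e / 2] after division by
    [n]. *)
Let narrow_lower (I : Type) (F : set_system I) (u : I -> bprob R X) mu f :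
  Filter F ->
  (forall G : set X, open G -> forall e : R, 0 < e ->
    \forall i \near F, fine (mu G) - e <= fine (u i G)) ->
  continuous f -> (forall x, 0 <= f x <= 1) ->
  forall e : R, 0 < e -> \forall i \near F, Ex mu f - e <= Ex (u i) f.
Proof.
move=> FF h cf f01 e e0.
have bf : bmeas (f : borel X -> R).
  by apply: (@continuous_bmeas _ _ _ 1) => // x; have /andP[? ?] := f01 x; rewrite ger0_norm.
have e20 : 0 < e / 2 by rewrite divr_gt0.
have [n n0 ne] : exists2 n, (0 < n)%N & n%:R^-1 <= e / 2.
  have [k] := ltr_add_invr e20; rewrite add0r => /ltW kn.
  by exists k.+1.
have : \forall i \near F, forall k : 'I_n,
    fine (mu (lay n f k)) - e / 2 <= fine (u i (lay n f k)).
  by apply: filter_forall => k; apply: h => //; exact: lay_open.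
apply: filterS => i hi.
have nR : 0 < n%:R :> R by rewrite ltr0n.
rewrite -(ler_pM2l nR) -ExZ//.
apply: (@le_trans _ _ (Ex (u i) (layf n f))); last first.
  apply: le_Ex; [exact: layf_bmeas|exact: bmeasZ|] => x.
  by apply: layf_le; have /andP[] := f01 x.
rewrite layf_Ex// mulrBr -ExZ//.
have : Ex mu (fun x => n%:R * f x) <= 1 + Ex mu (layf n f).
  rewrite -[X in X + _](Ex_cst mu 1) -ExD; [|exact: bmeas_cst|exact: layf_bmeas].
  apply: le_Ex; [exact: bmeasZ| |]; first by apply: bmeasD; [exact: bmeas_cst|exact: layf_bmeas].
  by move=> x; apply: layf_ge; have /andP[] := f01 x.
rewrite layf_Ex// => h1.
have h2 : \sum_(k < n) fine (mu (lay n f k)) - n%:R * (e / 2) <=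
    \sum_(k < n) fine (u i (lay n f k)).
  rewrite -[n in n%:R * _]card_ord mulr_natl -sumr_const -sumrB.
  exact: ler_sum.
have h3 : 1 <= n%:R * (e / 2) by rewrite mulrC -ler_pdivrMr ?mul1r.
lra.
Qed.

Lemma portmanteau_open (I : Type) (F : set_system I) (u : I -> bprob R X) mu :
  Filter F ->
  (forall G : set X, open G -> forall e : R, 0 < e ->
    \forall i \near F, fine (mu G) - e <= fine (u i G)) ->
  u @ F --> mu.
Proof.
move=> FF h; apply/narrow_cvgP => f cbf; have [cf [K' fK']] := cbf.
pose K := `|K'| + 1; have K0 : 0 < K by rewrite /K ltr_wpDl.
have fK x : `|f x| <= K by rewrite (le_trans (fK' x))// /K (le_trans (ler_norm _))// lerDl.
(* The values [s = 1] and [s = -1] rescale [f] and [-f] into [[0, 1]]; the lower bound for [-f] is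
   the missing upper bound for [f]. *)
pose g s x := (2 * K)^-1 * (K + s * f x).
have g01 s x : `|s| <= 1 -> 0 <= g s x <= 1.
  move=> s1; have : `|s * f x| <= K by rewrite normrM -[K]mul1r ler_pM.
  rewrite ler_norml => /andP[h1 h2]; rewrite /g mulr_ge0 ?invr_ge0 ?mulr_ge0//=; [|exact: ltW|lra].
  by rewrite mulrC ler_pdivrMr ?mulr_gt0//; lra.
have cbg s : cb (g s) by apply/cbZ/cbD; [exact: cb_cst|exact: cbZ].
have Eg s (P : probability (borel X) R) : Ex P (g s) = (2 * K)^-1 * (K + s * Ex P f).
  rewrite /g ExZ; last by apply/cb_bmeas/cbD; [exact: cb_cst|exact: cbZ].
  rewrite ExD; [|exact: bmeas_cst|exact/cb_bmeas/cbZ].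
  by rewrite ExZ ?Ex_cst//; exact: cb_bmeas.
apply/cvgrPdist_le => e e0.
have eK : 0 < (2 * K)^-1 * e by rewrite mulr_gt0// invr_gt0 mulr_gt0.
have lo s : `|s| <= 1 -> \forall i \near F, s * Ex mu f - e <= s * Ex (u i) f.
  move=> s1; have := narrow_lower FF h (cbg s).1 (fun x => g01 s x s1) eK.
  apply: filterS => i; rewrite !Eg -mulrBr ler_pM2l ?invr_gt0 ?mulr_gt0//; lra.
have := lo 1; rewrite normr1 lexx => /(_ isT) h1.
have := lo (-1); rewrite normrN1 lexx => /(_ isT) h2.
near=> i.
have : 1 * Ex mu f - e <= 1 * Ex (u i) f by near: i.
have : -1 * Ex mu f - e <= -1 * Ex (u i) f by near: i.
by rewrite ler_norml => *; apply/andP; split; lra.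
Unshelve. all: by end_near. Qed.

End Portmanteau.

Section PortmanteauClosed.
Context {R : realType} {X : ptopologicalType} (d : X -> X -> R).
Hypotheses (dd : is_distance d) (dt : induces_topology d).

Lemma bump_cb (k : R) C : 0 <= k -> cb (bump d k C).
Proof.
move=> k0; split; first exact: bump_continuous.
by exists 1 => x; rewrite ger0_norm ?bump_ge0 ?bump_le1.
Qed.

(** Bumps dominate the indicator of [C], so [c] bounds their expectations under [u i] and, in the
    limit, under [mu]; sharpening the bumps then leads to [mu C]. *)
Lemma portmanteau_closed (I : Type) (F : set_system I) (u : I -> bprob R X)
    (mu : bprob R X) (C : set X) (c : R) : ProperFilter F -> u @ F --> mu ->
  closed C -> (\forall i \near F, c <= fine (u i C)) -> c <= fine (mu C).
Proof.
move=> FF /narrow_cvgP umu cC hc.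
have mC : measurable (C : set (borel X)) by exact: closed_borel.
have h n : c <= Ex mu (bump d n%:R C).
  have bn : cb (bump d n%:R C) by exact: bump_cb.
  apply: cvg_ge_near (umu _ bn) _.
  apply: filterS hc => i /le_trans; apply.
  rewrite fine_Ex//; apply: le_Ex; [exact: bmeas_indic|exact: cb_bmeas|] => x.
  rewrite indicE; have [/set_mem xC|_] := boolP (x \in C); last by rewrite bump_ge0.
  by rewrite bump_eq1.
have := Ex_bump_cvg dd dt (P := mu) cC.
by move=> /cvg_ge_near; apply; exact: nearW.
Qed.

Lemma narrow_unique (I : Type) (F : set_system I) (u : I -> bprob R X)
    (mu nu : bprob R X) : ProperFilter F -> u @ F --> mu -> u @ F --> nu -> mu = nu.
Proof.
move=> FF /narrow_cvgP h1 /narrow_cvgP h2; apply: (bprob_cb_eq dd dt) => k C k0.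
have cbb := bump_cb C k0.
by apply: cvg_unique (h1 _ cbb) (h2 _ cbb); exact: Rhausdorff.
Qed.

End PortmanteauClosed.

(** * Push-forwards along continuous maps *)

Section Push.
Context {R : realType} {X Y : ptopologicalType} (h : X -> Y).
Hypothesis ch : continuous h.

Let mh : {mfun borel X >-> borel Y} := mfun_Sub (mem_set (continuous_borel ch)).

Definition push (mu : bprob R X) : bprob R Y := to_bprob (distribution mu mh).

Lemma pushE (mu : bprob R X) (A : set (borel Y)) : measurable A ->
  push mu A = mu (h @^-1` A).
Proof. by move=> mA; rewrite /push to_bprobE. Qed.

Lemma integral_push (mu : bprob R X) (f : borel Y -> \bar R) :
  measurable_fun setT f -> (\int[push mu]_y f y = \int[mu]_x f (h x))%E.
Proof.
move=> mf; rewrite (@eq_measure_integral _ _ _ _ (distribution mu mh)); last first.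
  by move=> A mA _; rewrite [LHS]to_bprobE.
rewrite integralE ge0_integral_distribution//; last exact: measurable_funepos.
rewrite ge0_integral_distribution//; last exact: measurable_funeneg.
rewrite [RHS]integralE; congr (_ - _)%E; apply: eq_integral => x _ /=.
  by rewrite !funeposE.
by rewrite !funenegE.
Qed.

Lemma Ex_push (mu : bprob R X) (f : Y -> R) :
  measurable_fun setT (f : borel Y -> R) -> Ex (push mu) f = Ex mu (f \o h).
Proof.
move=> mf; rewrite /Ex /Rintegral integral_push//.
exact/measurable_EFinP.
Qed.

Lemma push_cvg (I : Type) (F : set_system I) (u : I -> bprob R X) (mu : bprob R X) :
  Filter F -> u @ F --> mu -> push (u i) @[i --> F] --> push mu.
Proof.
move=> FF /narrow_cvgP umu; apply/narrow_cvgP => f cbf.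
rewrite Ex_push; last by have [] := cb_bmeas cbf.
rewrite (_ : (fun i => _) = (fun i => Ex (u i) (f \o h))); last first.
  by apply/funext => i; rewrite Ex_push; last by have [] := cb_bmeas cbf.
apply: umu; case: cbf => cf [K fK]; split; last by exists K => x; exact: fK.
by move=> x; apply: continuous_comp; [exact: ch|exact: cf].
Qed.

End Push.

(** * Prokhorov's theorem *)

Section UltraCompact.
Context {X : topologicalType} {I : Type} (U : set_system I) (UU : UltraFilter U).

(** If the preimage of a neighbourhood of the cluster point were not in [U], its complement would
    be, which contradicts clustering. *)
Lemma ultra_compact_cvg (u : I -> X) (K : set X) : compact K ->
  U (u @^-1` K) -> exists2 x, K x & u @ U --> x.
Proof.
move=> cK UK; have PU : ProperFilter U by exact: ultra_proper.
have [x [Kx cx]] := cK (u @ U) _ UK.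
exists x => // A Ax; have [//|UA] := in_ultra_setVsetC (u @^-1` A) UU.
by have [y [nAy Ay]] := cx (~` A) A UA Ax.
Qed.

End UltraCompact.

Section UltrafilterLimits.
Context {R : realType} {I : Type} (U : set_system I) (UU : UltraFilter U).

Lemma ultra_bounded_cvg (g : I -> R) (K : R) :
  (forall i, `|g i| <= K) -> exists l : R, g i @[i --> U] --> l.
Proof.
move=> gK; have PU : ProperFilter U by exact: ultra_proper.
have [|l _ gl] := ultra_compact_cvg UU (u := g) (@segment_compact R (- K) K).
  by apply: filterS filterT => i _; rewrite /= in_itv/= -ler_norml.
by exists l.
Qed.

End UltrafilterLimits.

Section MetricTopology.
Context {R : realType} {X : ptopologicalType} (d : X -> X -> R).
Hypotheses (dd : is_distance d) (dt : induces_topology d).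

Lemma dist_hausdorff : hausdorff_space X.
Proof.
move=> p q pq; apply: (dist0_eq dd); apply/eqP; rewrite eq_le (dist_ge0 dd) andbT.
rewrite leNgt; apply/negP => d0.
have e0 : 0 < d p q / 2 by rewrite divr_gt0.
have [z [/= pz qz]] := pq _ _ (nbhs_dist dt p e0) (nbhs_dist dt q e0).
by have := dist_tri dd z p q; rewrite (distC dd z q); lra.
Qed.

Lemma compact_borel (K : set X) : compact K -> measurable (K : set (borel X)).
Proof.
by move=> cK; apply: closed_borel; apply: compact_closed cK; exact: dist_hausdorff.
Qed.

Lemma bump_le_k k k' (C : set X) x : 0 <= k -> k <= k' -> bump d k' C x <= bump d k C x.
Proof.
move=> k0 kk'; apply: bump_ub => [|y Cy]; first exact: bump_ge0.
apply: le_trans (bump_lb dd k0 x Cy).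
by rewrite lerD2l lerN2 ler_wpM2r ?dist_ge0.
Qed.

End MetricTopology.

Section Prokhorov.
Context {R : realType} {X : ptopologicalType} (d : X -> X -> R).
Hypotheses (dd : is_distance d) (dt : induces_topology d).
Context {I : Type} (U : set_system I) (UU : UltraFilter U).
Variable u : I -> bprob R X.
Hypothesis tight : forall e : R, 0 < e ->
  exists2 K : set X, compact K & \forall i \near U, 1 - e <= fine (u i K).

Let PU : ProperFilter U. Proof. exact: ultra_proper. Qed.
#[local] Existing Instance PU.

(* [Lam] will be represented by a measure as in the Riesz theorem; tightness enters
   only through [Lam_dini]. *)
Let Lam (f : X -> R) : R := lim (Ex (u i) f @[i --> U]).

Let Lam_cvg f : cb f -> Ex (u i) f @[i --> U] --> Lam f.
Proof.
move=> cf; have [_ [K fK]] := cf.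
have [l hl] : exists l : R, Ex (u i) f @[i --> U] --> l.
  by apply: (@ultra_bounded_cvg _ _ _ UU _ K) => i; apply: normr_Ex_le => //; exact: cb_bmeas.
by rewrite /Lam (cvg_lim _ hl).
Qed.

Let Lam_eq f l : Ex (u i) f @[i --> U] --> l -> Lam f = l.
Proof. by move=> h; exact: (cvg_lim _ h). Qed.

Let LamD f g : cb f -> cb g -> Lam (fun x => f x + g x) = Lam f + Lam g.
Proof.
move=> cf cg; apply: Lam_eq.
rewrite (_ : (fun i => _) = (fun i => Ex (u i) f + Ex (u i) g)).
  by apply: cvgD; exact: Lam_cvg.
by apply/funext => i; rewrite ExD//; exact: cb_bmeas.
Qed.

Let LamZ c f : cb f -> Lam (fun x => c * f x) = c * Lam f.
Proof.
move=> cf; apply: Lam_eq.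
rewrite (_ : (fun i => _) = (fun i => c * Ex (u i) f)).
  by apply: cvgM; [exact: cvg_cst|exact: Lam_cvg].
by apply/funext => i; rewrite ExZ//; exact: cb_bmeas.
Qed.

Let Lam_cst c : Lam (cst c) = c.
Proof.
apply: Lam_eq; rewrite (_ : (fun i => _) = cst c); first exact: cvg_cst.
by apply/funext => i; exact: Ex_cst.
Qed.

Let le_Lam f g : cb f -> cb g -> (forall x, f x <= g x) -> Lam f <= Lam g.
Proof.
move=> cf cg fg; rewrite -subr_ge0.
apply: cvg_ge_near (cvgB (Lam_cvg cg) (Lam_cvg cf)) _; apply: nearW => i.
by rewrite !fctE subr_ge0; apply: le_Ex => //; exact: cb_bmeas.
Qed.

Let Lam_sum n (F : nat -> X -> R) : (forall k, cb (F k)) ->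
  cb (fun x => \sum_(k < n) F k x) /\
  Lam (fun x => \sum_(k < n) F k x) = \sum_(k < n) Lam (F k).
Proof.
move=> cF; elim: n => [|n [ih1 ih2]].
  rewrite big_ord0 (_ : (fun x => _) = cst 0); last first.
    by apply/funext => x; rewrite big_ord0.
  by split; [exact: cb_cst|exact: Lam_cst].
rewrite big_ord_recr/= -ih2 -LamD//.
rewrite (_ : (fun x => _) = (fun x => \sum_(k < n) F k x + F n x)); last first.
  by apply/funext => x; rewrite big_ord_recr.
by split=> //; exact: cbD.
Qed.

(** Dini's theorem on a compact set of mass at least [1 - e / 2], on which the functions are
    eventually below [e / 2]; off that set they are at most 1. *)
Let Lam_dini (F : nat -> X -> R) : (forall n, cb (F n)) ->
  (forall n x, 0 <= F n x <= 1) ->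
  (forall m n x, (m <= n)%N -> F n x <= F m x) ->
  (forall x (e : R), 0 < e -> exists n, F n x < e) ->
  forall e : R, 0 < e -> exists n, Lam (F n) <= e.
Proof.
move=> cF F01 dF F0 e e0; have e20 : 0 < e / 2 by rewrite divr_gt0.
have [K cK tK] := tight e20.
have : \forall n \near \oo, K `<=` [set x | F n x < e / 2].
  move/compact_near_coveringP : cK; apply => x Kx.
  have [m Fm] := F0 x _ e20.
  exists ([set y | F m y < e / 2], [set n | (m <= n)%N]) => /=.
    split; last by exists m.
    have /continuousP/(_ _ (@open_lt _ (e / 2))) oF := (cF m).1.
    exact: open_nbhs_nbhs.
  by move=> [y n]/= [Fy mn]; exact: le_lt_trans (dF _ _ _ mn) Fy.
case=> n _ /(_ n (leqnn n)) Kn; exists n.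
have mK := compact_borel dd dt cK.
have mnK : measurable (~` K : set (borel X)) by exact: measurableC.
apply: cvg_le_near (Lam_cvg (cF n)) _.
apply: filterS tK => i tKi.
apply: (@le_trans _ _ (Ex (u i) (fun x => e / 2 + \1_(~` K) x))).
  apply: le_Ex; [exact: cb_bmeas| |].
    by apply: bmeasD; [exact: bmeas_cst|exact: bmeas_indic].
  move=> x; have /andP[_ h1] := F01 n x; rewrite indicE; have [Kx|nKx] := pselect (K x).
    rewrite (@memNset _ (~` K)); last by move=> /(_ Kx).
    by rewrite addr0; exact/ltW/Kn.
  by rewrite mem_set//=; apply: le_trans h1 _; rewrite lerDr ltW.
rewrite ExD; [|exact: bmeas_cst|exact: bmeas_indic].
rewrite Ex_cst.
have -> : Ex (u i) \1_(~` K) = 1 - fine (u i K).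
  apply: EFin_inj; rewrite Ex_indic// EFinB fineK ?fin_num_measure//.
  exact: probability_setC.
by lra.
Qed.

Let below (G : set X) (f : X -> R) : Prop :=
  [/\ cb f, forall x, 0 <= f x <= 1 & forall x, ~ G x -> f x = 0].

(** As in the Riesz construction, except that test functions only vanish off [G]: compactly
    supported ones may be too few in a space that is not locally compact. *)
Let lam (G : set X) : R := sup [set Lam f | f in below G].

Let Lam01 f : cb f -> (forall x, 0 <= f x <= 1) -> 0 <= Lam f <= 1.
Proof.
move=> cf f01; have c0 := cb_cst (X := X) (0 : R); have c1 := cb_cst (X := X) (1 : R).
rewrite -[X in X <= _](Lam_cst 0) -[X in _ <= _ <= X](Lam_cst 1).
by apply/andP; split; apply: le_Lam => // x; case/andP: (f01 x).
Qed.

Let below0 G : below G (cst 0).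
Proof. by split=> [|x|//]; [exact: cb_cst|rewrite lexx ler01]. Qed.

Let lam_has G : has_sup [set Lam f | f in below G].
Proof.
split; first by exists (Lam (cst 0)); exists (cst 0).
by exists 1 => _ [f [cf f01 _] <-]; case/andP: (Lam01 cf f01).
Qed.

Let lam_ge G f : below G f -> Lam f <= lam G.
Proof. by move=> h; apply: ub_le_sup; [case: (lam_has G)|exists f]. Qed.

Let lam_le G c : (forall f, below G f -> Lam f <= c) -> lam G <= c.
Proof.
by move=> h; apply: ge_sup => [|_ [f bf <-]]; [case: (lam_has G)|exact: h].
Qed.

Let lam_ge0 G : 0 <= lam G.
Proof. by have := lam_ge (below0 G); rewrite Lam_cst. Qed.

Let lam_le1 G : lam G <= 1.
Proof. by apply: lam_le => f [cf f01 _]; case/andP: (Lam01 cf f01). Qed.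

Let lam_mono G H : G `<=` H -> lam G <= lam H.
Proof.
move=> GH; apply: lam_le => f [cf f01 f0]; apply: lam_ge; split=> // x nHx.
by apply: f0 => /GH.
Qed.

Let lamT : lam setT = 1.
Proof.
apply/eqP; rewrite eq_le lam_le1/= -[leLHS]Lam_cst; apply: lam_ge; split=> //.
- exact: cb_cst.
- by move=> x; rewrite /= ler01 lexx.
- by move=> x /(_ Logic.I).
Qed.

(** With [S m] the sum of the first [m] functions approaching the indicators of the [G k] from
    below, the excess of [f] over [S m] decreases to 0 at every point, and [Lam_dini] makes it
    negligible at a finite stage. *)
Let lam_subadd (G : nat -> set X) f : (forall k, open (G k)) ->
  below (\bigcup_k G k) f -> forall e : R, 0 < e ->
  exists m, Lam f <= \sum_(k < m) lam (G k) + e.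
Proof.
move=> oG [cf f01 f0] e e0.
pose phi m k x : R := 1 - bump d m%:R (~` G k) x.
have cphi m k : cb (phi m k) by apply: cbB; [exact: cb_cst|exact: bump_cb].
have phi01 m k x : 0 <= phi m k x <= 1.
  by rewrite /phi subr_ge0 bump_le1//= gerBl bump_ge0.
pose S m x := \sum_(k < m) phi m k x.
have cS m : cb (S m) by case: (Lam_sum m (cphi m)).
have S0 m x : 0 <= S m x by apply: sumr_ge0 => k _; case/andP: (phi01 m k x).
have mS m n x : (m <= n)%N -> S m x <= S n x.
  move=> mn; rewrite /S -(subnKC mn) big_split_ord/= ler_wpDr//.
    by apply: sumr_ge0 => k _; case/andP: (phi01 (m + (n - m))%N (m + k)%N x).
  apply: ler_sum => k _; rewrite /phi lerD2l lerN2 subnKC//.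
  by apply: bump_le_k; rewrite ?ler_nat.
pose F m x := Num.max 0 (f x - S m x).
have cF m : cb (F m).
  split.
    move=> x; apply: (@continuous_max _ _ (cst 0) (fun x => f x - S m x) x).
      exact: cvg_cst.
    by have [+ _] := cbB cf (cS m); exact.
  exists 1 => x; have /andP[f0x f1x] := f01 x; have := S0 m x.
  by rewrite ger0_norm /F ?le_max ?lexx// ge_max ler01/=; lra.
have [m hm] : exists m, Lam (F m) <= e.
  apply: (@Lam_dini F) => //.
  - move=> m x; have /andP[f0x f1x] := f01 x; have := S0 m x.
    by rewrite /F le_max lexx ge_max ler01/=; lra.
  - move=> m n x mn; rewrite /F ge_max le_max lexx/= le_max; apply/orP; right.
    by rewrite lerD2l lerN2 mS.
  move=> x e' e'0; suff [m Fm] : exists m, f x <= S m x.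
    by exists m; rewrite /F max_l// subr_le0.
  have [[k _ Gkx]|nG] := pselect ((\bigcup_k G k) x); last first.
    by exists 0%N; rewrite f0.
  have [r r0 hr] := (open_dist dt (G k)).1 (oG k) x Gkx.
  have [n hn] : exists n, 1 <= n%:R * r.
    have [n] := ltr_add_invr r0; rewrite add0r => h.
    by exists n.+1; rewrite mulrC -ler_pdivrMr// mul1r ltW.
  (* [m >= n] makes the bump on the complement of [G k] vanish at [x], and [m > k] includes the term
     of index [k] in [S m]. *)
  pose m := (n + k.+1)%N; exists m.
  have km : (k < m)%N by rewrite /m addnS ltnS leq_addl.
  apply: (@le_trans _ _ (phi m k x)).
    rewrite /phi (bump_eq0 dd) ?subr0//; first by case/andP: (f01 x).
    move=> y nGy; apply: le_trans hn _; apply: ler_pM => //; first exact: ltW.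
      by rewrite ler_nat leq_addr.
    by rewrite leNgt; apply/negP => /hr.
  rewrite /S (bigD1 (Ordinal km))//= lerDl; apply: sumr_ge0 => j _.
  by case/andP: (phi01 m j x).
exists m; apply: (@le_trans _ _ (Lam (fun x => S m x + F m x))).
  apply: le_Lam => // [|x]; first exact: cbD.
  by rewrite /F -lerBlDl le_max lexx orbT.
rewrite LamD// lerD//; have [_ ->] := Lam_sum m (cphi m).
apply: ler_sum => k _; apply: lam_ge; split=> // x nGx.
by rewrite /phi bump_eq1 ?subrr.
Qed.

Let out (A : set X) : R := inf [set lam G | G in [set G | open G /\ A `<=` G]].

Let out_has A : has_inf [set lam G | G in [set G | open G /\ A `<=` G]].
Proof.
split; first by exists (lam setT), setT => //; split=> //; exact: openT.
by exists 0 => _ [G _ <-].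
Qed.

Let out_le A G : open G -> A `<=` G -> out A <= lam G.
Proof. by move=> oG AG; apply: ge_inf; [case: (out_has A)|exists G]. Qed.

Let out_ge A c : (forall G, open G -> A `<=` G -> c <= lam G) -> c <= out A.
Proof.
by move=> h; apply: lb_le_inf => [|_ [G [oG AG] <-]]; [case: (out_has A)|exact: h].
Qed.

Let out_open G : open G -> out G = lam G.
Proof.
move=> oG; apply/eqP; rewrite eq_le out_le//=.
by apply: out_ge => H _; exact: lam_mono.
Qed.

Let out_ge0 A : 0 <= out A. Proof. by apply: out_ge. Qed.

Let out_ex A (e : R) : 0 < e -> exists G, [/\ open G, A `<=` G & lam G <= out A + e].
Proof.
move=> e0; have [_ [G [oG AG] <-] h] := inf_adherent e0 (out_has A).
by exists G; split=> //; exact: ltW.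
Qed.

Definition outer_ext (A : set X) : \bar R := (out A)%:E.

Let outer_ext0 : outer_ext set0 = 0%E.
Proof.
congr EFin; rewrite out_open; last exact: open0.
apply/eqP; rewrite eq_le lam_ge0 andbT; apply: lam_le => f [_ _ f0].
by rewrite (_ : f = cst 0) ?Lam_cst//; apply/funext => x; exact: f0.
Qed.

Let outer_ext_ge0 A : (0 <= outer_ext A)%E. Proof. by rewrite lee_fin. Qed.

Let outer_ext_subadd A F : subset_sigma_subadditive outer_ext A F.
Proof.
move=> AF; apply/lee_addgt0Pr => e e0; have e20 : 0 < e / 2 by rewrite divr_gt0.
(* Error budget: [e / 2] spread geometrically over the open covers, [e / 4] for a nearly optimal
   [f], and [e / 4] for [lam_subadd]. *)
have ek k : 0 < e / 2 / (2 ^ k.+1)%:R by rewrite divr_gt0// ltr0n expn_gt0.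
have /choice[G hG] := fun k => out_ex (F k) (ek k).
have oG k : open (G k) by case: (hG k).
have : (outer_ext A <= (\sum_(k <oo) outer_ext (F k) + (e / 2)%:E) + (e / 2)%:E)%E.
  apply: (@le_trans _ _ (lam (\bigcup_k G k))%:E).
    rewrite lee_fin; apply: out_le; first exact: bigcup_open.
    by apply: subset_trans AF _ => x [k _ Fx]; exists k => //; case: (hG k) => _ + _; apply.
  rewrite -leeBlDr//= -EFinB.
  apply: (@le_trans _ _ (\sum_(k <oo) (lam (G k))%:E)%E); last first.
    apply: le_trans (epsilon_trick _ _ (ltW e20)); last by move=> k; exact: outer_ext_ge0.
    apply: lee_nneseries => k _; first by rewrite lee_fin.
    by rewrite -EFinD lee_fin; case: (hG k).
  have [f bf hf] : exists2 f, below (\bigcup_k G k) f & lam (\bigcup_k G k) - e / 4 < Lam f.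
    have e4 : 0 < e / 4 by rewrite divr_gt0.
    by have [_ [f bf <-] ?] := sup_adherent e4 (lam_has (\bigcup_k G k)); exists f.
  have e4 : 0 < e / 4 by rewrite divr_gt0.
  have [m hm] := lam_subadd oG bf e4.
  apply: (@le_trans _ _ (\sum_(k < m) lam (G k))%:E); first by rewrite lee_fin; lra.
  rewrite -sumEFin -(big_mkord xpredT (fun k => (lam (G k))%:E)).
  by apply: nneseries_lim_ge => k _ _; rewrite lee_fin.
by rewrite -addeA -EFinD -splitr.
Qed.

HB.instance Definition _ :=
  isSubsetOuterMeasure.Build R X outer_ext outer_ext0 outer_ext_ge0 outer_ext_subadd.

(** It suffices to test against open [W]. For [f] below the part of [W] in [G], the open part [V] of
    [W] where [f < e] contains [A] minus [G]. If [g] is below [V] then [f + g <= 1 + e], so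
    [(f + g) / (1 + e)] is below [W]. *)
Let open_caratheodory (G : set X) : open G -> outer_ext.-caratheodory G.
Proof.
move=> oG; apply: le_caratheodory_measurable => A.
rewrite /= /outer_ext -EFinD lee_fin; apply: out_ge => W oW AW.
suff : out (A `&` G) <= lam W - out (A `&` ~` G) by lra.
apply: (@le_trans _ _ (lam (W `&` G))).
  by apply: out_le; [exact: openI|exact: setSI].
apply: lam_le => f [cf f01 f0]; rewrite lerBrDr.
apply/ler_addgt0Pr => e e0.
pose V := W `&` [set x | f x < e].
have oV : open V.
  apply: openI => //; have /continuousP/(_ _ (@open_lt _ e)) := cf.1.
  exact.
have AV : A `&` ~` G `<=` V.
  move=> x [Ax nGx]; split; first exact: AW.
  by rewrite /= f0// => -[].
apply: (@le_trans _ _ (Lam f + lam V)); first by rewrite lerD2l out_le.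
suff : lam V <= lam W + e - Lam f by lra.
apply: lam_le => g [cg g01 g0].
have e1 : 0 < 1 + e by rewrite addr_gt0.
pose h x := (1 + e)^-1 * (f x + g x).
have ch : cb h by apply/cbZ/cbD.
have bh : below W h.
  split=> // x.
    have /andP[f0x f1x] := f01 x; have /andP[g0x g1x] := g01 x.
    apply/andP; split.
      by apply: mulr_ge0; [rewrite invr_ge0 ltW|exact: addr_ge0].
    rewrite /h mulrC ler_pdivrMr// mul1r; have [[_ /= fe]|/g0 ->] := pselect (V x); lra.
  move=> nWx; rewrite /h f0 ?g0 ?addr0 ?mulr0//; by case.
have := lam_ge bh; rewrite LamZ; last exact: cbD.
rewrite LamD// mulrC ler_pdivrMr// mulrDr mulr1.
by have := ler_wpM2l (ltW e0) (lam_le1 W); rewrite mulr1 (mulrC e); lra.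
Qed.

Let borel_cara (A : set (borel X)) : measurable A ->
  outer_ext.-cara.-measurable (A : set (caratheodory_type outer_ext)).
Proof.
move: A; apply: smallest_sub; first exact: sigma_algebra_measurable.
by move=> G oG; exact: open_caratheodory.
Qed.

Let limE (A : set (borel X)) : \bar R := outer_ext A.

Let limE_sigma_additive : semi_sigma_additive limE.
Proof.
move=> F mF tF mUF.
apply: (@caratheodory_measure_sigma_additive R X outer_ext F) => //.
  by move=> k; exact: borel_cara.
exact: borel_cara.
Qed.

HB.instance Definition _ :=
  isMeasure.Build _ (borel X) R limE outer_ext0 outer_ext_ge0 limE_sigma_additive.

Let limE_setT : limE setT = 1%E.
Proof. by congr EFin; rewrite out_open ?lamT//; exact: openT. Qed.

HB.instance Definition _ :=
  Measure_isProbability.Build _ (borel X) R limE limE_setT.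

(** By [portmanteau_open] only lower bounds on open sets are needed: an [f] below [G] that nearly
    attains [lam G] satisfies [Ex (u i) f <= u i G], and its expectations tend to [Lam f]. *)
Theorem prokhorov_ultra : exists mu : bprob R X, u i @[i --> U] --> mu.
Proof.
exists (to_bprob limE); apply: portmanteau_open => G oG e e0.
have -> : fine (to_bprob limE G) = lam G.
  by rewrite to_bprobE; [rewrite -out_open|exact: open_borel].
have e20 : 0 < e / 2 by rewrite divr_gt0.
have [_ [f [cf f01 f0] <-] hf] := sup_adherent e20 (lam_has G).
have /cvgrPdist_lt/(_ _ e20) := Lam_cvg cf.
apply: filterS => i hi.
have mG := open_borel oG.
have : Ex (u i) f <= fine (u i G).
  rewrite fine_Ex//; apply: le_Ex; [exact: cb_bmeas|exact: bmeas_indic|] => x.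
  have /andP[f0x f1x] := f01 x; rewrite indicE.
  by have [Gx|nGx] := pselect (G x); [rewrite mem_set|rewrite memNset// f0].
by move: hi; rewrite ltr_norml => /andP[? ?]; rewrite -/(lam G) in hf; lra.
Qed.

End Prokhorov.

(** * The bounded-Lipschitz distance *)

Section DenseSequence.
Context {R : realType} {X : ptopologicalType} (d : X -> X -> R).
Hypotheses (dd : is_distance d) (dt : induces_topology d).

Lemma separable_dense_sequence : separable X ->
  exists x_ : nat -> X, forall x (e : R), 0 < e -> exists n, d x (x_ n) < e.
Proof.
move=> [D cD dD]; have [g gD] := pcard_surjP cD.
exists g => x e e0; have ox : open [set y | d x y < e].
  by have /continuousP/(_ _ (@open_lt _ e)) := distr_continuous dd dt (x := x).
have [|y [/= xy Dy]] := dD _ _ ox; first by exists x; rewrite /= (distxx dd).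
by have [n _ ny] := gD y Dy; exists n; rewrite ny.
Qed.

End DenseSequence.

Section BoundedLipschitz.
Context {R : realType} {X : ptopologicalType} (d : X -> X -> R).
Hypotheses (dd : is_distance d) (dt : induces_topology d).
Implicit Types (mu nu : bprob R X) (f : X -> R).

Definition lip1 f : Prop :=
  (forall x, `|f x| <= 1) /\ forall x y, `|f x - f y| <= d x y.

Lemma lip1_cb f : lip1 f -> cb f.
Proof.
move=> [f1 fl]; split; last by exists 1.
by apply: (@lip_continuous _ _ _ dd dt _ 1) => x y; rewrite mul1r.
Qed.

(* Bounded-Lipschitz distance. A weighted series over countably many test functions
   would also metrize the narrow topology, but it would not be complete. *)
Definition BL mu nu : R := sup [set `|Ex mu f - Ex nu f| | f in lip1].

Let BL_has mu nu : has_sup [set `|Ex mu f - Ex nu f| | f in lip1].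
Proof.
split.
  exists `|Ex mu (cst 0) - Ex nu (cst 0)|, (cst 0) => //; split=> [x|x y] /=.
    by rewrite normr0.
  by rewrite subrr normr0 dist_ge0.
exists 2 => _ [f [f1 fl] <-]; have cf : cb f by exact: lip1_cb.
rewrite (le_trans (ler_normB _ _))// (_ : 2 = 1 + 1)//.
by rewrite lerD// normr_Ex_le//; exact: cb_bmeas.
Qed.

Lemma BL_ge mu nu f : lip1 f -> `|Ex mu f - Ex nu f| <= BL mu nu.
Proof. by move=> h; apply: ub_le_sup; [case: (BL_has mu nu)|exists f]. Qed.

Lemma BL_le mu nu c : (forall f, lip1 f -> `|Ex mu f - Ex nu f| <= c) ->
  BL mu nu <= c.
Proof.
by move=> h; apply: ge_sup => [|_ [f bf <-]]; [case: (BL_has mu nu)|exact: h].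
Qed.

(** The factor serves two bounds: [1 / (1 + k) <= 1] for the values and [k / (1 + k) <= 1] for the
    Lipschitz constant. *)
Lemma bump_lip1 (k : R) C : 0 <= k -> lip1 (fun x => (1 + k)^-1 * bump d k C x).
Proof.
move=> k0; have k1 : 0 < 1 + k by rewrite ltr_pwDl.
split=> [x|x y].
  rewrite ger0_norm ?mulr_ge0 ?invr_ge0 ?(ltW k1) ?bump_ge0//.
  rewrite mulrC ler_pdivrMr// mul1r (le_trans (bump_le1 dd _ _ _))//.
  by rewrite lerDl.
rewrite -mulrBr normrM ger0_norm ?invr_ge0 ?(ltW k1)// mulrC ler_pdivrMr//.
rewrite (le_trans (bump_lip dd _ _ _ _))// mulrC ler_wpM2l ?dist_ge0//.
by rewrite lerDr.
Qed.

Lemma BL_bump mu nu (k : R) C : 0 <= k ->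
  `|Ex mu (bump d k C) - Ex nu (bump d k C)| <= (1 + k) * BL mu nu.
Proof.
move=> k0; have k1 : 0 < 1 + k by rewrite ltr_pwDl.
have := BL_ge mu nu (bump_lip1 C k0).
have bb : bmeas (bump d k C : borel X -> R) by exact: bump_bmeas.
rewrite !ExZ// -mulrBr normrM ger0_norm ?invr_ge0 ?(ltW k1)//.
by rewrite mulrC ler_pdivrMr// mulrC.
Qed.

Lemma BL_distance : is_distance BL.
Proof.
split.
- move=> mu; apply/eqP; rewrite eq_le BL_le/=; last by move=> f _; rewrite subrr normr0.
  apply: (le_trans _ (BL_ge mu mu (bump_lip1 set0 (lexx 0)))).
  by rewrite normr_ge0.
- move=> mu nu h0; apply: (bprob_cb_eq dd dt) => k C k0.
  have := BL_bump mu nu C k0; rewrite h0 mulr0 normr_le0 subr_eq0 => /eqP.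
  exact.
- by move=> mu nu; congr sup; apply/seteqP; split=> _ [f lf <-]; exists f => //;
    rewrite distrC.
- move=> nu mu rho; apply: BL_le => f lf.
  by rewrite (le_trans (ler_distD (Ex nu f) _ _))// lerD// BL_ge.
Qed.

Let BL_ball mu : set_system (bprob R X) :=
  filter_from [set e : R | 0 < e] (fun e => [set nu | BL mu nu < e]).

Let BL_ball_filter mu : Filter (BL_ball mu).
Proof.
apply: filter_from_filter; first by exists 1; rewrite /= ltr01.
move=> a b /= a0 b0; exists (Num.min a b); first by rewrite /= lt_min a0 b0.
by move=> nu /=; rewrite lt_min => /andP[].
Qed.

(** This is the half of [BL_topology] that puts a ball inside each narrow neighbourhood. By the
    portmanteau criterion only open [G] matter; a bump on the complement of [G] has [mu]-expectation
    within [e / 2] of the mass of that complement and changes by at most [(1 + n) * BL mu nu],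
    whence the radius. *)
Lemma BL_ball_cvg mu : BL_ball mu --> mu.
Proof.
have FF := BL_ball_filter mu.
suff : id @ BL_ball mu --> mu by [].
apply: portmanteau_open => G oG e e0.
have e20 : 0 < e / 2 by rewrite divr_gt0.
have cG : closed (~` G) by exact: open_closedC.
have mG : measurable (~` G : set (borel X)) by exact: closed_borel.
have mG' : measurable (G : set (borel X)) by exact: open_borel.
have /cvgrPdist_le/(_ _ e20)[n _ /(_ n (leqnn n))/=] :=
  Ex_bump_cvg dd dt (P := mu) cG.
have n1 : 0 < 1 + n%:R :> R by rewrite ltr_pwDl.
rewrite ler_norml => /andP[hn _].
exists (e / 2 / (1 + n%:R)); first by rewrite /= divr_gt0.
move=> nu /= hnu; rewrite /id.
have := BL_bump mu nu (~` G) (ler0n R n); rewrite ler_norml => /andP[h1 _].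
have h2 : (1 + n%:R) * BL mu nu < e / 2 by rewrite mulrC -ltr_pdivlMr.
have h3 : fine (nu (~` G)) <= Ex nu (bump d n%:R (~` G)).
  rewrite fine_Ex//; apply: le_Ex; [exact: bmeas_indic|exact: bump_bmeas|] => x.
  rewrite indicE; have [/set_mem xC|_] := boolP (x \in ~` G); last by rewrite bump_ge0.
  by rewrite bump_eq1.
have fC (P : bprob R X) : fine (P (~` G)) = 1 - fine (P G).
  by apply: EFin_inj; rewrite EFinB !fineK ?fin_num_measure//; exact: probability_setC.
by move: hn h3; rewrite !fC; lra.
Qed.

Variable x_ : nat -> X.
Hypothesis dense_x : forall x (e : R), 0 < e -> exists n, d x (x_ n) < e.

(* For fixed [k], the increments of [psi k n] in [n] form a partition of unity into
   bumps of radius [1 / k] around the points [x_ n]. *)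
Definition psi (k : R) (n : nat) : X -> R := bump d k [set x_ j | j in `I_n].

Lemma psi_cvg1 (k : R) x : 0 <= k -> psi k n x @[n --> \oo] --> (1 : R).
Proof.
move=> k0; apply/cvgrPdist_le => e e0; have k1 : 0 < 1 + k by rewrite ltr_pwDl.
have [m hm] := dense_x x (divr_gt0 e0 k1).
exists m.+1 => // n /= mn; rewrite ger0_norm ?subr_ge0 ?bump_le1//.
have : 1 - k * d x (x_ m) <= psi k n x by apply: bump_lb => //; exists m.
have : k * d x (x_ m) <= e.
  rewrite (@le_trans _ _ ((1 + k) * d x (x_ m)))//.
    by rewrite ler_wpM2r ?dist_ge0// lerDr.
  by rewrite mulrC -ler_pdivlMr// ltW.
lra.
Qed.

Lemma psi_bmeas (k : R) n : 0 <= k -> bmeas (psi k n : borel X -> R).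
Proof. by move=> k0; exact: bump_bmeas. Qed.

Lemma Ex_psi_cvg1 mu (k : R) : 0 <= k -> Ex mu (psi k n) @[n --> \oo] --> (1 : R).
Proof.
move=> k0; rewrite -[X in _ --> X](Ex_cst mu 1); apply: (@Ex_cvg _ _ _ _ _ _ 1).
- by move=> n; exact: psi_bmeas.
- by move=> n x; rewrite ger0_norm ?bump_ge0 ?bump_le1.
- by move=> x; exact: psi_cvg1.
Qed.

Lemma le_psi (k : R) m n x : 0 <= k -> (m <= n)%N -> psi k m x <= psi k n x.
Proof.
move=> k0 mn; apply: bump_ub => [|_ [j jm <-]]; first exact: bump_ge0.
by apply: bump_lb => //; exists j => //; exact: leq_trans jm mn.
Qed.

Let S (k : R) n f x : R := \sum_(i < n) f (x_ i) * (psi k i.+1 x - psi k i x).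

(** Only points [x_ i] with [d x (x_ i) < k^-1] have a nonzero increment at [x], and there
    [f (x_ i)] is within [k^-1] of [f x]. The weight [1 - psi k n x] not yet distributed costs at
    most itself, as [f] is bounded by 1. *)
Let S_approx (k : R) n f x : 0 < k -> lip1 f ->
  `|f x - S k n f x| <= k^-1 + (1 - psi k n x).
Proof.
move=> k0 [f1 fl]; have k0' := ltW k0.
have h : `|f x * psi k n x - S k n f x| <= k^-1 * psi k n x.
  rewrite /S; elim: n => [|n ih].
    rewrite big_ord0 (_ : psi k 0 x = 0) ?mulr0 ?subrr ?normr0//.
    by rewrite /psi (bump_eq0 dd)// => y [].
  rewrite big_ord_recr/=.
  have -> : f x * psi k n.+1 x - (\sum_(i < n) f (x_ i) * (psi k i.+1 x - psi k i x)
      + f (x_ n) * (psi k n.+1 x - psi k n x)) =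
    (f x * psi k n x - \sum_(i < n) f (x_ i) * (psi k i.+1 x - psi k i x)) +
    (f x - f (x_ n)) * (psi k n.+1 x - psi k n x) by lra.
  have mpsi := le_psi x k0' (leqnSn n).
  rewrite (le_trans (ler_normD _ _))//.
  have -> : k^-1 * psi k n.+1 x = k^-1 * psi k n x + k^-1 * (psi k n.+1 x - psi k n x) by lra.
  rewrite lerD// normrM [X in _ * X]ger0_norm ?subr_ge0//.
  (* Either [x_ n] is close enough for the Lipschitz bound, or its bump is 0 at [x] and the
     increment vanishes. *)
  have [xn|xn] := ltP (d x (x_ n)) k^-1.
    by rewrite ler_wpM2r ?subr_ge0// (le_trans (fl _ _))// ltW.
  suff -> : psi k n.+1 x = psi k n x by rewrite subrr !mulr0.
  apply/eqP; rewrite eq_le mpsi andbT; apply: bump_ub => [|_ [j /= jn <-]].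
    exact: bump_ge0.
  move: jn; rewrite ltnS leq_eqVlt => /predU1P[->|jn].
    apply: (@le_trans _ _ 0); last exact: bump_ge0.
    by rewrite subr_le0 mulrC -ler_pdivrMr// mul1r.
  by apply: bump_lb => //; exists j.
have p1 : psi k n x <= 1 by exact: bump_le1.
have -> : f x - S k n f x = (f x * psi k n x - S k n f x) + f x * (1 - psi k n x) by lra.
rewrite (le_trans (ler_normD _ _))// lerD//.
  by rewrite (le_trans h)// ler_piMr// invr_ge0.
rewrite normrM [X in _ * X]ger0_norm ?subr_ge0//.
by rewrite ler_piMl// subr_ge0.
Qed.

Let bS (k : R) n f : 0 <= k -> bmeas (S k n f : borel X -> R).
Proof.
move=> k0; apply: (@bmeas_sum _ (borel X) _ n
  (fun i x => f (x_ i) * (psi k i.+1 x - psi k i x))) => i _.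
by apply: bmeasZ; apply: bmeasB; exact: psi_bmeas.
Qed.

Let Ex_S mu (k : R) n f : 0 <= k ->
  Ex mu (S k n f) = \sum_(i < n) f (x_ i) * (Ex mu (psi k i.+1) - Ex mu (psi k i)).
Proof.
move=> k0; rewrite /S (@Ex_sum _ (borel X) _ _ n
  (fun i x => f (x_ i) * (psi k i.+1 x - psi k i x))).
  apply: eq_bigr => i _; rewrite ExZ; last by apply: bmeasB; exact: psi_bmeas.
  by rewrite ExB//; exact: psi_bmeas.
by move=> i _; apply: bmeasZ; apply: bmeasB; exact: psi_bmeas.
Qed.

Let Ex_S_approx mu (k : R) n f : 0 < k -> lip1 f ->
  `|Ex mu f - Ex mu (S k n f)| <= k^-1 + (1 - Ex mu (psi k n)).
Proof.
move=> k0 lf; have k0' := ltW k0; have bf := cb_bmeas (lip1_cb lf).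
have bp := psi_bmeas n k0'; have bS' := bS n f k0'.
have -> : k^-1 + (1 - Ex mu (psi k n)) = Ex mu (fun x => k^-1 + (1 - psi k n x)).
  rewrite ExD; [|exact: bmeas_cst|by apply: bmeasB => //; exact: bmeas_cst].
  by rewrite ExB//; [rewrite !Ex_cst|exact: bmeas_cst].
have bR : bmeas (fun x : borel X => k^-1 + (1 - psi k n x)).
  by apply: bmeasD; [exact: bmeas_cst|apply: bmeasB => //; exact: bmeas_cst].
have h x : - (k^-1 + (1 - psi k n x)) <= f x - S k n f x <= k^-1 + (1 - psi k n x).
  by rewrite -ler_norml S_approx.
rewrite -ExB// ler_norml; apply/andP; split.
  rewrite -[X in - X <= _]mul1r -mulNr -ExZ//; apply: le_Ex => //.
  - exact: bmeasZ.
  - exact: bmeasB.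
  - by move=> x; rewrite mulN1r; case/andP: (h x).
by apply: le_Ex => //; [exact: bmeasB|move=> x; case/andP: (h x)].
Qed.

(** The bound is uniform in [f], so finitely many bump expectations control the whole supremum.
    Exchanging [1 - Ex nu (psi k n)] for the term of [mu] costs the single [e]; each of the [n]
    increments differs by at most [2 * e]. *)
Lemma BL_psi mu nu (k e : R) n : 0 < k ->
  (forall i, (i <= n)%N -> `|Ex mu (psi k i) - Ex nu (psi k i)| <= e) ->
  BL mu nu <= 2 * k^-1 + 2 * (1 - Ex mu (psi k n)) + e + (e * 2) *+ n.
Proof.
move=> k0 h; apply: BL_le => f lf.
have h1 := Ex_S_approx mu n k0 lf; have h2 := Ex_S_approx nu n k0 lf.
have h3 : `|Ex mu (S k n f) - Ex nu (S k n f)| <= (e * 2) *+ n.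
  rewrite (Ex_S mu n f (ltW k0)) (Ex_S nu n f (ltW k0)) -sumrB.
  apply: (le_trans (ler_norm_sum _ _ _)).
  rewrite -[n in leRHS]card_ord -sumr_const; apply: ler_sum => i _.
  rewrite -mulrBr normrM -[leRHS]mul1r ler_pM//; first by case: lf.
  have := h i.+1 (ltn_ord i); have := h i (ltnW (ltn_ord i)).
  by rewrite !ler_norml => /andP[? ?] /andP[? ?]; apply/andP; split; lra.
have := h n (leqnn n).
move: h1 h2 h3; rewrite !ler_norml => /andP[? ?] /andP[? ?] /andP[? ?] /andP[? ?].
by apply/andP; split; lra.
Qed.

Lemma BL_test mu (e : R) : 0 < e -> exists (k n : nat) (r : R), 0 < r /\
  forall nu, (forall i, (i <= n)%N -> `|Ex mu (psi k.+1%:R i) - Ex nu (psi k.+1%:R i)| <= r) ->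
    BL mu nu < e.
Proof.
move=> e0; have e8 : 0 < e / 8 by rewrite divr_gt0.
have [k] := ltr_add_invr e8; rewrite add0r => hk.
have := Ex_psi_cvg1 mu (ler0n R k.+1) => /cvgrPdist_le/(_ _ e8)[n _].
move=> /(_ n (leqnn n))/=; rewrite ler_norml => /andP[_ hn].
(* The radius [r] solves [r + 2 * r * n = e / 8]; with the choice of [k] and [n], the bound of
   [BL_psi] stays below [5 * e / 8]. *)
exists k, n, (e / 8 / (1 + 2 *+ n)); split; first by rewrite divr_gt0// ltr_pwDl// mulrn_wge0.
move=> nu /BL_psi/le_lt_trans; apply; first by rewrite ltr0n.
have n0 : 0 < 1 + 2 *+ n :> R by rewrite ltr_pwDl// mulrn_wge0.
set a := _ / (1 + _).
have ha : a + (a * 2) *+ n = e / 8.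
  by rewrite -mulrnAr -{1}[a]mulr1 -mulrDr /a divfK// gt_eqF.
by set b := _ *+ n in ha *; set c := _^-1 in hk *; set p := Ex mu _ in hn *; lra.
Qed.

Lemma BL_topology : induces_topology BL.
Proof.
move=> mu A; split.
  by move=> /BL_ball_cvg.
move=> [e e0 eA]; have [k [n [r [r0 hr]]]] := BL_test mu e0.
have : \forall nu \near nbhs (mu : bprob R X), forall i : 'I_n.+1,
    `|Ex (mu : bprob R X) (psi k.+1%:R i) - Ex (nu : bprob R X) (psi k.+1%:R i)| <= r.
  apply: filter_forall => i.
  have /narrow_cvgP/(_ _ (bump_cb dd dt [set x_ j | j in `I_i] (ler0n R k.+1))) :
    id @ nbhs mu --> mu by [].
  by move=> /cvgrPdist_le/(_ _ r0).
apply: filterS => nu h; apply: eA; apply: hr => i ni.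
by have := h (Ordinal (ni : (i < n.+1)%N)).
Qed.

(** A code [(k, n, p, s)] prescribes the expectations of [psi k.+1%:R i], [i <= n], up to
    [p.+1%:R^-1] by the rationals [s]. One measure is picked per code, [point] if none fits; by
    [BL_test], measures sharing a fine enough code are close. *)
Lemma BL_separable : separable (bprob R X).
Proof.
pose B (t : nat * nat * nat * seq rat) : set (bprob R X) :=
  [set nu : bprob R X | forall i, (i <= t.1.1.2)%N ->
    `|Ex nu (psi t.1.1.1.+1%:R i) - ratr (nth 0 t.2 i)| <= t.1.2.+1%:R^-1].
exists (range (fun t => xget point (B t))).
  by apply: sub_countable (card_image_le _ _) _; exact: countableP.
move=> O [mu Omu] oO.
have [e e0 eO] : exists2 e, 0 < e & [set nu | BL mu nu < e] `<=` O.
  by apply/BL_topology; exact: open_nbhs_nbhs.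
have [k [n [r [r0 hr]]]] := BL_test mu e0.
have r20 : 0 < r / 2 by rewrite divr_gt0.
have [p] := ltr_add_invr r20; rewrite add0r => hp.
have /choice[s hs] : forall i : nat, exists q : rat,
    `|Ex mu (psi k.+1%:R i) - ratr q| <= p.+1%:R^-1.
  move=> i; set a := Ex mu _.
  have [q] := @rat_in_itvoo R (a - p.+1%:R^-1) a (ltac:(by rewrite gtrBl invr_gt0 ltr0n)).
  rewrite in_itv/= => /andP[q1 q2]; exists q.
  by rewrite ger0_norm ?subr_ge0 ?(ltW q2)// lerBlDl -lerBlDr ltW.
pose t := (k, n, p, mkseq s n.+1).
have Bmu : B t mu by move=> i /= ni; rewrite nth_mkseq.
exists (xget point (B t)); split; last by exists t.
have Bt : B t (xget point (B t)) by apply: xgetPex; exists mu.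
apply: eO; apply: hr => i ni.
have := Bt i ni; have := Bmu i ni; rewrite /= => h1 h2.
set b := ratr _ in h1 h2; rewrite (le_trans (ler_distD b _ _))//.
rewrite [X in _ + X]distrC [leRHS]splitr lerD// ?(le_trans h1)// ?(le_trans h2)//; exact: ltW.
Qed.

End BoundedLipschitz.

(** * Tightness and completeness *)

Lemma ultra_bigcup_ord (T : Type) (F : set_system T) (n : nat) (A : nat -> set T) :
  UltraFilter F -> F [set x | exists2 i, (i < n)%N & A i x] ->
  exists2 i, (i < n)%N & F (A i).
Proof.
move=> UF FA; have PF : ProperFilter F by exact: ultra_proper.
apply: contrapT => h.
have : F [set x | forall i : 'I_n, ~ A i x].
  apply: filter_forall => i.
  have [FAi|//] := in_ultra_setVsetC (A i) UF.
  by exfalso; apply: h; exists i.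
move=> /(filterI FA)/filter_ex[x /= [[i iN Aix] /(_ (Ordinal iN))]].
exact.
Qed.

Section Tightness.
Context {R : realType} {X : ptopologicalType} (d : X -> X -> R).
Hypotheses (dd : is_distance d) (dt : induces_topology d) (dc : complete_distance d).
Variable x_ : nat -> X.
Hypothesis dense_x : forall x (e : R), 0 < e -> exists n, d x (x_ n) < e.

Local Notation psi := (psi d x_).

(** An ultrafilter on this set contains, for each [k], a ball of radius [k.+1%:R^-1] around one of
    finitely many points. Any two of these balls meet, so the centres form a Cauchy sequence, and
    the ultrafilter converges to its limit. *)
Lemma totally_bounded_compact (N : nat -> nat) :
  compact (\bigcap_k [set x | 2^-1 <= psi k.+1%:R (N k) x]).
Proof.
set K := \bigcap_k _; rewrite compact_ultra => F UF FK.
have PF : ProperFilter F by exact: ultra_proper.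
have FC k : F [set x | 2^-1 <= psi k.+1%:R (N k) x].
  by apply: filterS FK => x; exact.
have /choice[i hi] : forall k, exists i, F [set x | d x (x_ i) < k.+1%:R^-1].
  move=> k; suff : F [set x | exists2 i, (i < N k)%N & d x (x_ i) < k.+1%:R^-1].
    move=> /(@ultra_bigcup_ord _ _ _ (fun i => [set x | d x (x_ i) < k.+1%:R^-1]) UF).
    by move=> [i _ Fi]; exists i.
  apply: filterS (FC k) => x /= hx.
  have : 0 < psi k.+1%:R (N k) x by rewrite (lt_le_trans _ hx)// invr_gt0.
  move=> /(bump_pos dd)[// | _ [j jN <-] h]; exists j => //.
  by rewrite -[ltRHS]mul1r ltr_pdivlMr// mulrC.
pose v k := x_ (i k).
have dv m n : d (v m) (v n) < m.+1%:R^-1 + n.+1%:R^-1.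
  have [x [/= h1 h2]] := filter_ex (filterI (hi m) (hi n)).
  rewrite (le_lt_trans (dist_tri dd x _ _))// (distC dd _ x); exact: ltrD.
have small (e : R) : 0 < e -> exists M, forall n, (M <= n)%N -> n.+1%:R^-1 < e.
  move=> e0; have [M] := ltr_add_invr e0; rewrite add0r => hM.
  exists M => n Mn; apply: le_lt_trans hM.
  by rewrite lef_pV2 ?posrE ?ltr0n// ler_nat.
have [x vx] : exists x : X, v @ \oo --> x.
  apply: dc => e e0; have [M hM] := small _ (divr_gt0 e0 (ltr0n R 2)).
  exists M => m n Mm Mn; rewrite (lt_le_trans (dv m n))//.
  by rewrite [leRHS]splitr lerD// ltW// hM.
have Fx : F --> x.
  move=> A /dt[e e0 eA].
  have [M hM] := small _ (divr_gt0 e0 (ltr0n R 2)).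
  have [n [Mn hn]] : exists n, (M <= n)%N /\ d x (v n) < e / 2.
    have /vx[M' _ hM'] := nbhs_dist dt x (divr_gt0 e0 (ltr0n R 2)).
    exists (maxn M M'); split; first exact: leq_maxl.
    by apply: hM'; exact: leq_maxr.
  apply: filterS (hi n) => y /= hy; apply: eA => /=.
  rewrite (le_lt_trans (dist_tri dd (v n) _ _))// [ltRHS]splitr ltrD// (distC dd).
  by rewrite (lt_trans hy)// hM.
exists x; split=> // k _.
have cC : closed [set x | 2^-1 <= psi k.+1%:R (N k) x].
  have /continuous_closedP/(_ _ (@closed_ge _ 2^-1)) :=
    bump_continuous dd dt (C := [set x_ j | j in `I_(N k)]) (ler0n R k.+1).
  exact.
exact: (@closed_cvg _ _ F PF id _ cC (FC k) x Fx).
Qed.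

Lemma tight_family (T : set (bprob R X)) :
  (forall k (e : R), 0 < e -> exists n, forall mu : bprob R X, T mu ->
    1 - e <= Ex mu (psi k.+1%:R n)) ->
  forall e : R, 0 < e -> exists2 K : set X, compact K &
    forall mu : bprob R X, T mu -> 1 - e <= fine (mu K).
Proof.
move=> h e e0.
(* Markov's inequality at the threshold 1/2 doubles the defect of the expectation, hence the final
   division by 2; the powers of 2 sum to a total loss of [e]. *)
have ek k : 0 < e / (2 ^ k.+1)%:R / 2 by rewrite !divr_gt0// ltr0n expn_gt0.
have /choice[N hN] := fun k => h k _ (ek k).
pose C k := [set x | 2^-1 <= psi k.+1%:R (N k) x].
have cK : compact (\bigcap_k C k) by exact: totally_bounded_compact.
exists (\bigcap_k C k) => // mu Tmu.
have mK : measurable (\bigcap_k C k : set (borel X)) by exact: (compact_borel dd dt cK).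
have mC k : measurable (~` C k : set (borel X)).
  apply: open_borel; rewrite openC.
  have /continuous_closedP/(_ _ (@closed_ge _ 2^-1)) :=
    bump_continuous dd dt (C := [set x_ j | j in `I_(N k)]) (ler0n R k.+1).
  exact.
have muC k : (mu (~` C k) <= (e / (2 ^ k.+1)%:R)%:E)%E.
  rewrite -Ex_indic// lee_fin.
  have bp : bmeas (psi k.+1%:R (N k) : borel X -> R) by exact: psi_bmeas.
  have : Ex mu (fun x => 2^-1 * \1_(~` C k) x) <= Ex mu (fun x => 1 - psi k.+1%:R (N k) x).
    apply: le_Ex; [apply: bmeasZ; exact: bmeas_indic|by apply: bmeasB => //; exact: bmeas_cst|].
    move=> x; rewrite indicE; have [Cx|nCx] := pselect (C k x).
      by rewrite memNset/= ?mulr0 ?subr_ge0 ?bump_le1//; move=> /(_ Cx).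
    rewrite mem_set// mulr1; move/negP : nCx; rewrite -ltNge => /ltW; lra.
  rewrite ExZ; last exact: bmeas_indic.
  rewrite ExB//; last exact: bmeas_cst.
  by rewrite Ex_cst; have := hN k mu Tmu; set a := _ / (2 ^ _)%:R; lra.
have muK : (mu (~` (\bigcap_k C k)) <= e%:E)%E.
  rewrite setC_bigcap; apply: (@le_trans _ _ (\sum_(k <oo) mu (~` C k))%E).
    apply: measure_sigma_subadditive => //; exact: bigcupT_measurable.
  apply: le_trans (epsilon_trick0 xpredT (ltW e0)).
  by apply: lee_nneseries => k _.
have /eqP := @probability_setC _ _ _ mu _ mK.
move: muK; rewrite -[mu (\bigcap_k C k)]fineK ?fin_num_measure//.
move=> /[swap] /eqP ->; rewrite -EFinB lee_fin; lra.
Qed.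

(** The terms up to index [M] share one [n] by [Ex_psi_cvg1]; the later ones are close to [u M], and
    [BL_bump] transfers the bound at the price of the factor [1 + k.+1%:R]. *)
Lemma BL_cauchy_tight (u : nat -> bprob R X) :
  (forall e : R, 0 < e -> exists N, forall m n, (N <= m)%N -> (N <= n)%N ->
    BL d (u m) (u n) < e) ->
  forall e : R, 0 < e -> exists2 K : set X, compact K &
    forall n, 1 - e <= fine (u n K).
Proof.
move=> cu e e0.
have [|K cK hK] := @tight_family (range u) _ e e0; last first.
  by exists K => // n; apply: hK; exists n.
move=> k r r0; have k2 : 0 < 1 + k.+1%:R :> R by rewrite ltr_pwDl.
have [M hM] := cu _ (divr_gt0 (divr_gt0 r0 (ltr0n R 2)) k2).
have : \forall n \near \oo, forall m : 'I_M.+1, 1 - r / 2 <= Ex (u m) (psi k.+1%:R n).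
  apply: filter_forall => m.
  have /cvgrPdist_le/(_ _ (divr_gt0 r0 (ltr0n R 2))) :=
    Ex_psi_cvg1 dd dt dense_x (u m) (ler0n R k.+1).
  by apply: filterS => n; rewrite ler_norml => /andP[_]; lra.
case=> n _ /(_ n (leqnn n)) hn; exists n => _ [m _ <-].
have [mM|Mm] := leqP m M.
  by have := hn (Ordinal (mM : (m < M.+1)%N)); rewrite /=; lra.
have := hn (Ordinal (leqnn M.+1)); rewrite /= => h1.
have := BL_bump dd dt (u m) (u M) [set x_ j | j in `I_n] (ler0n R k.+1).
rewrite -/(psi _ _) ler_norml => /andP[h2 _].
have := hM m M (ltnW Mm) (leqnn M); rewrite ltr_pdivlMr// mulrC; lra.
Qed.

(** A Cauchy sequence converges to any of its cluster points, here to the limit along an ultrafilter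
    that tightness provides. *)
Lemma BL_complete : complete_distance (BL d : bprob R X -> bprob R X -> R).
Proof.
move=> u cu; have tu := BL_cauchy_tight cu.
have [U [UU oU]] := @ultraFilterLemma nat \oo _.
have PU : ProperFilter U by exact: ultra_proper.
have [|mu umu] := @prokhorov_ultra _ _ _ dd dt _ U UU u.
  by move=> e /tu[K cK hK]; exists K => //; exact: nearW.
have BLd := BL_distance (R := R) dd dt.
exists mu => A /(BL_topology dd dt dense_x)[e e0 eA].
have [N hN] := cu _ (divr_gt0 e0 (ltr0n R 2)).
have : U [set n | BL d mu (u n) < e / 2].
  have : nbhs mu [set nu | BL d mu nu < e / 2].
    by apply/(BL_topology dd dt dense_x); exists (e / 2); rewrite ?divr_gt0.
  by move=> /umu.
have UN : U [set n | (N <= n)%N] by apply: oU; exists N.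
move=> /(filterI UN)/filter_ex[n /= [Nn hn]].
exists N => // m /= Nm; apply: eA => /=.
by rewrite (le_lt_trans (dist_tri BLd (u n) _ _))// [ltRHS]splitr ltrD// hN.
Qed.

End Tightness.

Section PolishSpace.
Context {R : realType} {X : ptopologicalType}.
Hypothesis pX : @polish R X.

Theorem polish_bprob : @polish R (bprob R X).
Proof.
have [sX [d [dd dt dc]]] := pX.
have [x_ dense_x] := separable_dense_sequence dd dt sX.
split; first exact: (BL_separable dd dt dense_x).
exists (BL d); split; [exact: BL_distance|exact: BL_topology dense_x|].
exact: BL_complete dense_x.
Qed.

(** A convergent sequence is Cauchy for [BL], so the tightness obtained on the way to completeness
    applies. *)
Lemma cvg_tight (u : nat -> bprob R X) (mu : bprob R X) : u @ \oo --> mu ->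
  forall e : R, 0 < e -> exists2 K : set X, compact K &
    forall n, 1 - e <= fine (u n K).
Proof.
move=> umu; have [sX [d [dd dt dc]]] := pX.
have [x_ dense_x] := separable_dense_sequence dd dt sX.
have BLd := BL_distance (R := R) dd dt.
apply: (BL_cauchy_tight dd dt dc dense_x) => e e0.
have : nbhs mu [set nu | BL d mu nu < e / 2].
  by apply/(BL_topology dd dt dense_x); exists (e / 2); rewrite ?divr_gt0.
move=> /umu[N _ hN]; exists N => m n Nm Nn.
rewrite (le_lt_trans (dist_tri BLd mu _ _))// [ltRHS]splitr ltrD// ?(distC BLd _ mu).
  exact: hN.
exact: hN.
Qed.

(** Ulam's theorem, read off from a constant sequence. *)
Lemma inner_compact (mu : bprob R X) (e : R) : 0 < e ->
  exists2 K : set X, compact K & 1 - e <= fine (mu K).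
Proof.
move=> e0; have [K cK hK] := @cvg_tight (fun=> mu) mu (cvg_cst mu) e e0.
by exists K => //; exact: hK 0%N.
Qed.

End PolishSpace.

(** * Products and couplings *)

Lemma preimage_borel (X Y : ptopologicalType) (f : X -> Y) (A : set Y) :
  continuous f -> measurable (A : set (borel Y)) ->
  measurable (f @^-1` A : set (borel X)).
Proof.
move=> cf mA; rewrite -[X in measurable X]setTI.
exact: (continuous_borel cf measurableT mA).
Qed.

Section ProductDistance.
Context {R : realType} {X Y : ptopologicalType}.
Variables (dX : X -> X -> R) (dY : Y -> Y -> R).
Hypotheses (ddX : is_distance dX) (ddY : is_distance dY).

Definition prod_dist (p q : X * Y) : R := Num.max (dX p.1 q.1) (dY p.2 q.2).

Lemma prod_dist_lt p q e : (prod_dist p q < e) = (dX p.1 q.1 < e) && (dY p.2 q.2 < e).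
Proof. by rewrite /prod_dist gt_max. Qed.

Lemma prod_dist_distance : is_distance prod_dist.
Proof.
split.
- by move=> p; rewrite /prod_dist (distxx ddX) (distxx ddY) maxxx.
- move=> p q h.
  have hX : dX p.1 q.1 <= 0 by rewrite -h /prod_dist le_max lexx.
  have hY : dY p.2 q.2 <= 0 by rewrite -h /prod_dist le_max lexx orbT.
  rewrite [p]surjective_pairing [q]surjective_pairing; congr pair.
    by apply: (dist0_eq ddX); apply/eqP; rewrite eq_le hX dist_ge0.
  by apply: (dist0_eq ddY); apply/eqP; rewrite eq_le hY dist_ge0.
- by move=> p q; rewrite /prod_dist (distC ddX) (distC ddY).
- move=> q p r; rewrite /prod_dist ge_max; apply/andP; split.
    by rewrite (le_trans (dist_tri ddX q.1 _ _))// lerD// le_max lexx.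
  by rewrite (le_trans (dist_tri ddY q.2 _ _))// lerD// le_max lexx orbT.
Qed.

Hypotheses (dtX : induces_topology dX) (dtY : induces_topology dY).

Lemma prod_dist_topology : induces_topology (prod_dist : (X * Y)%type -> (X * Y)%type -> R).
Proof.
move=> [x y] A; split.
  move=> [[P Q] /= [/dtX[e e0 eP] /dtY[e' e'0 eQ]] PQA].
  exists (Num.min e e'); first by rewrite lt_min e0.
  move=> [x' y'] /=; rewrite prod_dist_lt/= !lt_min => /andP[/andP[h1 _] /andP[_ h2]].
  by apply: PQA; split=> /=; [exact: eP|exact: eQ].
move=> [e e0 eA]; exists ([set x' | dX x x' < e], [set y' | dY y y' < e]) => /=.
  by split; exact: nbhs_dist.
move=> [x' y'] /= [h1 h2]; apply: eA.
by rewrite /= prod_dist_lt h1.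
Qed.

End ProductDistance.

Section PolishProduct.
Context {R : realType} {X Y : ptopologicalType}.

Lemma polish_prod : @polish R X -> @polish R Y -> @polish R (X * Y)%type.
Proof.
move=> [sX [dX [ddX dtX dcX]]] [sY [dY [ddY dtY dcY]]].
have [x_ hx] := separable_dense_sequence ddX dtX sX.
have [y_ hy] := separable_dense_sequence ddY dtY sY.
have dtP := prod_dist_topology dtX dtY.
split.
  exists (range (fun t : nat * nat => (x_ t.1, y_ t.2))).
    by apply: sub_countable (card_image_le _ _) _; exact: countableP.
  move=> O [p Op] oO.
  have /dtP[e e0 eO] : nbhs p O by exact: open_nbhs_nbhs.
  have [n hn] := hx p.1 e e0; have [m hm] := hy p.2 e e0.
  exists (x_ n, y_ m); split; last by exists (n, m).
  by apply: eO; rewrite /= prod_dist_lt hn.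
exists (prod_dist dX dY); split=> //; first exact: prod_dist_distance.
move=> u cu.
have [|x ux] := dcX (fst \o u).
  move=> e /cu[N hN]; exists N => m n Nm Nn.
  by have := hN m n Nm Nn; rewrite prod_dist_lt => /andP[].
have [|y uy] := dcY (snd \o u).
  move=> e /cu[N hN]; exists N => m n Nm Nn.
  by have := hN m n Nm Nn; rewrite prod_dist_lt => /andP[].
exists (x, y).
rewrite (_ : u = (fun n => ((fst \o u) n, (snd \o u) n))); first exact: cvg_pair.
by apply/funext => n /=; case: (u n).
Qed.

Lemma fst_continuous : continuous (fst : (X * Y)%type -> X).
Proof. by move=> p; exact: cvg_fst. Qed.

Lemma snd_continuous : continuous (snd : (X * Y)%type -> Y).
Proof. by move=> p; exact: cvg_snd. Qed.

End PolishProduct.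

Section Couplings.
Context {R : realType} {X Y : ptopologicalType}.
Hypotheses (pX : @polish R X) (pY : @polish R Y).

Definition is_coupling (mu : bprob R X) (nu : bprob R Y)
    (pi : bprob R (X * Y)%type) : Prop :=
  push (@fst_continuous X Y) pi = mu /\ push (@snd_continuous X Y) pi = nu.

(** [U] refines [\oo], so the marginals keep their limits along it, and closed conditions that the
    [pi_ n] satisfy only eventually still pass to the limit. *)
Lemma coupling_limit (mu_ : nat -> bprob R X) (nu_ : nat -> bprob R Y)
    (pi_ : nat -> bprob R (X * Y)%type) (mu : bprob R X) (nu : bprob R Y) :
  mu_ @ \oo --> mu -> nu_ @ \oo --> nu ->
  (forall n, is_coupling (mu_ n) (nu_ n) (pi_ n)) ->
  exists U : set_system nat, exists pi : bprob R (X * Y)%type,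
    [/\ ProperFilter U, \oo `<=` U, pi_ @ U --> pi & is_coupling mu nu pi].
Proof.
move=> cmu cnu hpi.
have [_ [dX [ddX dtX _]]] := pX; have [_ [dY [ddY dtY _]]] := pY.
have ddP := prod_dist_distance ddX ddY; have dtP := prod_dist_topology dtX dtY.
have [U [UU oU]] := @ultraFilterLemma nat \oo _.
have PU : ProperFilter U by exact: ultra_proper.
have [|pi hU] := @prokhorov_ultra _ _ _ ddP dtP _ U UU pi_.
  move=> e e0; have e20 : 0 < e / 2 by rewrite divr_gt0.
  have [K cK hK] := cvg_tight pX cmu e20; have [L cL hL] := cvg_tight pY cnu e20.
  exists (K `*` L); first exact: compact_setX.
  apply: nearW => n; have [h1 h2] := hpi n.
  have mKL : measurable (K `*` L : set (borel (X * Y)%type)).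
    by apply: (compact_borel ddP dtP); exact: compact_setX.
  have mK : measurable (K : set (borel X)) by exact: (compact_borel ddX dtX).
  have mL : measurable (L : set (borel Y)) by exact: (compact_borel ddY dtY).
  have := hK n; have := hL n; rewrite -h1 -h2 !pushE// => hL' hK'.
  have mfK : measurable (fst @^-1` K : set (borel (X * Y)%type)).
    by apply: preimage_borel => //; exact: fst_continuous.
  have mfL : measurable (snd @^-1` L : set (borel (X * Y)%type)).
    by apply: preimage_borel => //; exact: snd_continuous.
  move: hL' hK'; rewrite !fine_Ex// => hL' hK'.
  (* The indicator of the rectangle is at least the sum of the two cylinder indicators minus 1. *)
  apply: (@le_trans _ _ (Ex (pi_ n) (fun p => \1_(fst @^-1` K) p + \1_(snd @^-1` L) p - 1))).
    rewrite ExB; [|by apply: bmeasD; exact: bmeas_indic|exact: bmeas_cst].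
    by rewrite ExD ?Ex_cst; [lra|exact: bmeas_indic|exact: bmeas_indic].
  apply: le_Ex; [|exact: bmeas_indic|].
    apply: bmeasB; last exact: bmeas_cst.
    by apply: bmeasD; exact: bmeas_indic.
  move=> [x y]; rewrite !indicE.
  have [Kx|nKx] := pselect (K x); have [Ly|nLy] := pselect (L y).
  - by rewrite !mem_set//= addrK.
  - rewrite [_ \in fst @^-1` K]mem_set//= memNset// memNset; last by case.
    by rewrite addr0 subrr.
  - rewrite [_ \in fst @^-1` K]memNset//= mem_set// memNset; last by case.
    by rewrite add0r subrr.
  - by rewrite [_ \in fst @^-1` K]memNset//= memNset// memNset; [lra|case].
exists U, pi; split=> //; split.
  have c : push (@fst_continuous X Y) (pi_ n) @[n --> U] --> push (@fst_continuous X Y) pi.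
    exact: push_cvg.
  apply: (narrow_unique ddX dtX PU c).
  rewrite (_ : (fun n => _) = mu_); first exact: cvg_trans (cvg_app _ oU) cmu.
  by apply/funext => n; case: (hpi n).
have c : push (@snd_continuous X Y) (pi_ n) @[n --> U] --> push (@snd_continuous X Y) pi.
  exact: push_cvg.
apply: (narrow_unique ddY dtY PU c).
rewrite (_ : (fun n => _) = nu_); first exact: cvg_trans (cvg_app _ oU) cnu.
by apply/funext => n; case: (hpi n).
Qed.

End Couplings.

Section ClosedSequences.
Context {R : realType} {X : ptopologicalType} (d : X -> X -> R).
Hypotheses (dd : is_distance d) (dt : induces_topology d).

Lemma closed_seq (A : set X) :
  (forall (u : nat -> X) p, (forall n, A (u n)) -> u @ \oo --> p -> A p) -> closed A.
Proof.
move=> h p cp.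
have /choice[u hu] : forall n, exists y, A y /\ d p y < n.+1%:R^-1.
  move=> n; have [|y [Ay py]] := cp [set y | d p y < n.+1%:R^-1].
    by apply: nbhs_dist; rewrite ?invr_gt0.
  by exists y.
apply: (h u p) => [n|B /dt[e e0 eB]]; first by case: (hu n).
have [M] := ltr_add_invr e0; rewrite add0r => hM.
exists M => // n /= Mn; apply: eB => /=; have [_ pn] := hu n.
rewrite (lt_trans pn)// (le_lt_trans _ hM)//.
by rewrite lef_pV2 ?posrE ?ltr0n// ler_nat.
Qed.

End ClosedSequences.

Section CausalClosed.
Context {R : realType} {M : ptopologicalType} (l : M -> M -> \bar R).
Hypotheses (pM : @polish R M) (cl : closed (causal_set l)).

Let is_coupling_causal mu nu (pi : bprob R (M * M)%type) :
  coupling mu nu pi <-> is_coupling mu nu pi.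
Proof.
split=> [h|[h1 h2] A mA]; last by rewrite -{1}h1 -h2 !pushE.
by split; apply: bprob_ext => A mA; rewrite pushE//; case: (h A mA).
Qed.

Lemma causal_couplingP mu nu (pi : bprob R (M * M)%type) :
  causal_coupling l mu nu pi <-> is_coupling mu nu pi /\ pi (causal_set l) = 1%E.
Proof. by split=> -[/is_coupling_causal]. Qed.

Lemma closed_causal_coupling :
  closed [set p : bprob R M * bprob R M | causal_coupling l p.1 p.2 !=set0].
Proof.
have [_ [d [dd dt _]]] := polish_bprob pM.
have [_ [dP [ddP dtP _]]] := polish_prod pM pM.
apply: (closed_seq (prod_dist_topology dt dt)) => u p hu up.
have /choice[pi_ hpi] : forall n, exists pi, causal_coupling l (u n).1 (u n).2 pi.
  by move=> n; have [pi ?] := hu n; exists pi.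
have c1 : (fun n => (u n).1) @ \oo --> p.1.
  exact: cvg_comp up (@fst_continuous _ _ p).
have c2 : (fun n => (u n).2) @ \oo --> p.2.
  exact: cvg_comp up (@snd_continuous _ _ p).
have [n|U [pi [PU oU hU hp]]] := coupling_limit pM pM (pi_ := pi_) c1 c2.
  by have /causal_couplingP[] := hpi n.
exists pi; apply/causal_couplingP; split=> //.
have mC : measurable (causal_set l : set (borel (M * M)%type)) by exact: closed_borel.
apply/eqP; rewrite eq_le (@probability_le1 _ _ _ pi)//=.
rewrite -[pi _]fineK ?fin_num_measure// lee_fin.
apply: (portmanteau_closed ddP dtP PU hU cl); apply: nearW => n.
by have /causal_couplingP[_ ->] := hpi n.
Qed.

End CausalClosed.

(** * Closed upper sets and antisymmetry *)

Section UpperSets.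
Context {R : realType} {M : ptopologicalType} (l : M -> M -> \bar R).
Hypothesis cl : closed (causal_set l).

Definition upper (A : set M) : set M := [set y | exists2 x, A x & causal l x y].

(** Each [z] in the upper set gets a point [v z] of [K] in its past ([point] is a dummy elsewhere).
    Along an ultrafilter the [v z] converge in [K], and closedness of the causal relation carries
    over to the limit pair. *)
Lemma closed_upper (K : set M) : compact K -> closed (upper K).
Proof.
move=> cK; rewrite closure_id; apply/seteqP; split; first exact: subset_closure.
rewrite closureEcvg => y [G PG [Gy GK]].
have {}GK : G (upper K) by apply: GK.
have /choice[v hv] : forall z, exists x, upper K z -> K x /\ causal l x z.
  move=> z; have [[x Kx xz]|nz] := pselect (upper K z); first by exists x.
  by exists point.
have [U [UU GU]] := ultraFilterLemma PG.
have PU : ProperFilter U by exact: ultra_proper.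
have [|x Kx vx] := @ultra_compact_cvg M M U UU v K cK.
  by apply: filterS (GU _ GK) => z /hv[].
exists x => //.
have vy : (fun z => (v z, z)) @ U --> ((x, y) : (M * M)%type).
  by apply: cvg_pair => // A /Gy/GU.
apply: (@closed_cvg _ _ U PU _ _ cl _ _ vy).
by apply: filterS (GU _ GK) => z /hv[].
Qed.

Let mcausal : measurable (causal_set l : set (borel (M * M)%type)).
Proof. exact: closed_borel. Qed.

Let mfst (A : set M) : measurable (A : set (borel M)) ->
  measurable (fst @^-1` A : set (borel (M * M)%type)).
Proof.
by move=> mA; apply: preimage_borel => //; exact: fst_continuous.
Qed.

Let msnd (A : set M) : measurable (A : set (borel M)) ->
  measurable (snd @^-1` A : set (borel (M * M)%type)).
Proof.
by move=> mA; apply: preimage_borel => //; exact: snd_continuous.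
Qed.

Variables (mu nu : bprob R M) (pi : bprob R (M * M)%type).
Hypothesis hpi : causal_coupling l mu nu pi.

Let pi_nC : pi (~` causal_set l) = 0%E.
Proof.
have [_ h] := hpi; have := @probability_setC _ _ _ pi _ mcausal.
by rewrite h subee.
Qed.

(** On causal pairs [\1_A x <= \1_A y]; adding the indicator of the non-causal pairs, of expectation
    0, makes this hold everywhere. *)
Lemma causal_coupling_upset (A : set M) : measurable (A : set (borel M)) ->
  (forall x y, A x -> causal l x y -> A y) -> (mu A <= nu A)%E.
Proof.
move=> mA uA; have [h _] := hpi; have [<- <-] := h A mA.
rewrite -[leLHS]fineK ?fin_num_measure//; last exact: mfst.
rewrite -[leRHS]fineK ?fin_num_measure//; last exact: msnd.
rewrite lee_fin !fine_Ex; [|exact: msnd|exact: mfst].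
have mnC : measurable (~` causal_set l : set (borel (M * M)%type)) by exact: measurableC.
rewrite -[leRHS]addr0 -[X in _ + X](_ : Ex pi \1_(~` causal_set l) = 0); last first.
  by rewrite -fine_Ex// pi_nC.
rewrite -ExD; [|by apply: bmeas_indic; exact: msnd|exact: bmeas_indic].
apply: le_Ex; [by apply: bmeas_indic; exact: mfst| |].
  by apply: bmeasD; apply: bmeas_indic => //; exact: msnd.
move=> [x y]; rewrite !indicE.
have [Ax|nAx] := pselect (A x); last first.
  by rewrite [_ \in fst @^-1` A]memNset//= addr_ge0.
rewrite [_ \in fst @^-1` A]mem_set//=; have [xy|nxy] := pselect (causal l x y).
  by rewrite [_ \in snd @^-1` A]mem_set ?lerDl//; exact: uA Ax xy.
by rewrite [_ \in ~` _]mem_set ?lerDr.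
Qed.

Hypotheses (pM : @polish R M) (pl : partial_order (causal l)).

Lemma upper_upset (K : set M) x y : upper K x -> causal l x y -> upper K y.
Proof.
by move=> [z Kz zx] xy; exists z => //; have [_ tr _] := pl; exact: tr zx xy.
Qed.

Hypothesis eq_upset : forall A : set M, closed A ->
  (forall x y, A x -> causal l x y -> A y) -> mu A = nu A.

(** The indicator of this set is at most [\1_A y - \1_A x] plus the indicator of the non-causal
    pairs, a bound of expectation [nu A - mu A + 0 = 0]. *)
Let upset_null (A : set M) : closed A ->
  (forall x y, A x -> causal l x y -> A y) ->
  pi.-negligible [set p | A p.2 /\ ~ A p.1].
Proof.
move=> cA uA; have mA : measurable (A : set (borel M)) by exact: closed_borel.
have mN : measurable ([set p | A p.2 /\ ~ A p.1] : set (borel (M * M)%type)).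
  rewrite (_ : [set p | _] = snd @^-1` A `&` ~` (fst @^-1` A))//.
  by apply: measurableI; [exact: msnd|apply: measurableC; exact: mfst].
apply/(negligibleP _ mN); apply/eqP; rewrite eq_le measure_ge0 andbT.
rewrite -[X in (X <= _)%E]fineK ?fin_num_measure// lee_fin fine_Ex//.
have mnC : measurable (~` causal_set l : set (borel (M * M)%type)) by exact: measurableC.
have -> : 0 = Ex pi (fun p => \1_(snd @^-1` A) p - \1_(fst @^-1` A) p + \1_(~` causal_set l) p).
  have b1 := bmeas_indic (R := R) (msnd mA); have b2 := bmeas_indic (R := R) (mfst mA).
  rewrite ExD; [|exact: bmeasB|exact: bmeas_indic].
  rewrite ExB// -!fine_Ex//; [|exact: mfst|exact: msnd].
  have [h _] := hpi; have [-> ->] := h A mA.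
  by rewrite pi_nC (eq_upset cA uA) subrr addr0.
apply: le_Ex; [exact: bmeas_indic| |].
  apply: bmeasD; last exact: bmeas_indic.
  by apply: bmeasB; apply: bmeas_indic; [exact: msnd|exact: mfst].
move=> [x y]; rewrite !indicE.
have [Ay|nAy] := pselect (A y); have [Ax|nAx] := pselect (A x).
- rewrite memNset; last by case.
  by rewrite [_ \in snd @^-1` A]mem_set// [_ \in fst @^-1` A]mem_set//= subrr add0r.
- rewrite mem_set// [_ \in snd @^-1` A]mem_set// [_ \in fst @^-1` A]memNset//=.
  by rewrite subr0 lerDl.
- rewrite memNset; last by case.
  have nxy : ~ causal l x y by move=> /(uA _ _ Ax).
  rewrite [_ \in snd @^-1` A]memNset// [_ \in fst @^-1` A]mem_set//.
  by rewrite [_ \in ~` _]mem_set//= sub0r addNr.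
- rewrite memNset; last by case.
  by rewrite [_ \in snd @^-1` A]memNset// [_ \in fst @^-1` A]memNset//= subrr add0r.
Qed.

(* Each pair with [x <= y] and [x <> y] lies in some [V `*` U] with no causal
   relation from [U] to [V]; for compact [K] in [U] carrying almost all of [nu]
   on [U], the closed upper set of [K] contains [y] but not [x]. *)
Lemma causal_coupling_diagonal : pi.-negligible [set p | p.1 <> p.2].
Proof.
have [sM [d [dd dt _]]] := pM.
have [x_ hx] := separable_dense_sequence dd dt sM.
have /choice[K hK] : forall n, exists K : set M, compact K /\ 1 - n.+1%:R^-1 <= fine (nu K).
  move=> n; have n0 : 0 < n.+1%:R^-1 :> R by rewrite invr_gt0.
  by have [K cK hK] := inner_compact pM nu n0; exists K.
have mK n : measurable (K n : set (borel M)).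
  by apply: (compact_borel dd dt); case: (hK n).
pose B i k : set M := [set y | d (x_ i) y <= k.+1%:R^-1].
have cB i k : closed (B i k).
  have /continuous_closedP/(_ _ (@closed_le _ k.+1%:R^-1)) :=
    distr_continuous dd dt (x := x_ i).
  exact.
pose A n i k := upper (K n `&` B i k).
have cA n i k : closed (A n i k).
  by apply: closed_upper; apply: compact_closedI => //; case: (hK n).
have Anull n i k : pi.-negligible [set p | A n i k p.2 /\ ~ A n i k p.1].
  by apply: upset_null => // x y; exact: upper_upset.
(* The second coordinate has law [nu], and the complement of [K n] has [nu]-mass at most
   [n.+1%:R^-1]. *)
have Znull : pi.-negligible [set p | forall n, ~ K n p.2].
  have mZ : measurable (\bigcap_n (~` K n) : set (borel M)).
    by apply: bigcapT_measurable => n; exact: measurableC.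
  have mZ2 := msnd mZ.
  suff : pi.-negligible (snd @^-1` (\bigcap_n (~` K n))).
    by apply: negligibleS => p hp n _; exact: hp.
  apply/(negligibleP _ mZ2).
  have [h _] := hpi; have [_ E] := h _ mZ.
  transitivity (nu (\bigcap_n (~` K n))); first exact: E.
  apply/eqP; rewrite eq_le measure_ge0 andbT; apply/lee_addgt0Pr => e e0.
  have [n] := ltr_add_invr e0; rewrite add0r => ne.
  apply: (@le_trans _ _ (nu (~` K n))).
    by apply: le_measure; rewrite ?inE//; [exact: measurableC|exact: bigcap_inf].
  rewrite add0e (@probability_setC _ _ _ nu)//.
  rewrite -[nu _]fineK ?fin_num_measure// -EFinB lee_fin.
  by have [_] := hK n; set a := _^-1 in ne *; lra.
have Cnull : pi.-negligible (~` causal_set l).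
  by apply/negligibleP => //; exact: measurableC.
have Unull : pi.-negligible (\bigcup_n \bigcup_i \bigcup_k
    [set p | A n i k p.2 /\ ~ A n i k p.1]).
  by apply: negligible_bigcup => n; apply: negligible_bigcup => i; exact: negligible_bigcup.
apply: negligibleS (negligibleU (negligibleU Cnull Znull) Unull).
move=> [x y] /= xy.
have [cxy|] := pselect (causal l x y); last by left; left.
have [|/existsNP[n /contrapT Kny]] := pselect (forall n, ~ K n y); first by left; right.
right; exists n => //.
have nyx : ~ causal l y x.
  by move=> yx; apply: xy; have [_ _] := pl; exact.
(* Antisymmetry excludes [y <= x], so an [e]-neighbourhood of [(y, x)] contains no causal pair; [i]
   and [k] then put [y] in a ball whose points are all within [e] of [y]. *)
have := closed_dist (prod_dist_topology dt dt) cl (x := (y, x)) nyx.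
move=> [e e0 he]; have e20 : 0 < e / 2 by rewrite divr_gt0.
have [k] := ltr_add_invr e20; rewrite add0r => ke.
have k0 : 0 < k.+1%:R^-1 :> R by rewrite invr_gt0.
have [i hi] := hx y _ k0.
exists i => //; exists k => //; split.
  exists y; last by have [+ _ _] := pl; apply.
  by split=> //; rewrite /B /= (distC dd) ltW.
move=> [u [_ Bu] ux].
have : e <= prod_dist d d (y, x) (u, x) by apply: he.
apply/negP; rewrite -ltNge prod_dist_lt/= (distxx dd) e0 andbT.
rewrite (le_lt_trans (dist_tri dd (x_ i) _ _))// [ltRHS]splitr ltrD//.
  exact: lt_trans hi ke.
exact: le_lt_trans Bu ke.
Qed.

End UpperSets.

Section CausalOrder.
Context {R : realType} {M : ptopologicalType} (l : M -> M -> \bar R).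
Hypotheses (pM : @polish R M) (pl : partial_order (causal l)).
Hypothesis cl : closed (causal_set l).

Lemma causal_coupling_antisym (mu nu : bprob R M) pi pi' :
  causal_coupling l mu nu pi -> causal_coupling l nu mu pi' -> mu = nu.
Proof.
move=> h h'; have [N [mN N0 hN]] : pi.-negligible [set p | p.1 <> p.2].
  apply: (causal_coupling_diagonal cl h pM pl) => A cA uA.
  have mA := closed_borel cA.
  apply/eqP; rewrite eq_le (causal_coupling_upset cl h)//.
  by rewrite (causal_coupling_upset cl h').
apply: bprob_ext => A mA; have [/(_ A mA)[<- <-] _] := h.
have mf : measurable (fst @^-1` A : set (borel (M * M)%type)).
  by apply: preimage_borel => //; exact: fst_continuous.
have ms : measurable (snd @^-1` A : set (borel (M * M)%type)).
  by apply: preimage_borel => //; exact: snd_continuous.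
(* Adding the null set [N], which contains all off-diagonal pairs, makes the two preimages equal. *)
rewrite -(measureU0 mf mN N0) -(measureU0 ms mN N0); congr (pi _).
apply/seteqP; split=> -[x y] [Axy|]; try by right.
  have [exy|xy] := pselect (x = y); last by right; exact: hN.
  by left; rewrite /= -exy.
have [exy|xy] := pselect (x = y); last by right; exact: hN.
by left; rewrite /= exy.
Qed.

Let diag (x : M) : (M * M)%type := (x, x).

Let diag_continuous : continuous diag.
Proof. by move=> x; apply: cvg_pair; exact: cvg_id. Qed.

Lemma causal_coupling_diag (mu : bprob R M) :
  causal_coupling l mu mu (push diag_continuous mu).
Proof.
split.
  move=> A mA; split; rewrite pushE//; apply: preimage_borel => //.
    exact: fst_continuous.
  exact: snd_continuous.
rewrite pushE; last exact: closed_borel.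
rewrite (_ : _ @^-1` _ = setT); first exact: (@probability_setT _ _ _ mu).
by apply/seteqP; split=> // x _; have [+ _ _] := pl; apply.
Qed.

End CausalOrder.

(** * Gluing *)

Section ProductBorel.
Context {R : realType} {X Y : ptopologicalType}.
Hypotheses (pX : @polish R X) (pY : @polish R Y).

(** By separability an open set is a countable union of products of balls. Hence Borel sets of the
    product belong to the product sigma-algebra, on which product measures are defined. *)
Lemma open_prod_measurable (O : set (X * Y)%type) : open O ->
  measurable (O : set (borel X * borel Y)%type).
Proof.
move=> oO; have [sX [dX [ddX dtX _]]] := pX; have [sY [dY [ddY dtY _]]] := pY.
have [x_ hx] := separable_dense_sequence ddX dtX sX.
have [y_ hy] := separable_dense_sequence ddY dtY sY.
pose B i j k : set (X * Y)%type :=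
  [set x | dX (x_ i) x < k.+1%:R^-1] `*` [set y | dY (y_ j) y < k.+1%:R^-1].
have mB i j k : measurable (B i j k : set (borel X * borel Y)%type).
  apply: measurableX; apply: open_borel.
    by have /continuousP/(_ _ (@open_lt _ k.+1%:R^-1)) :=
      distr_continuous ddX dtX (x := x_ i).
  by have /continuousP/(_ _ (@open_lt _ k.+1%:R^-1)) :=
    distr_continuous ddY dtY (x := y_ j).
have -> : O = \bigcup_i \bigcup_j \bigcup_(k in [set k | B i j k `<=` O]) B i j k.
  apply/seteqP; split; last by move=> p [i _ [j _ [k /= kO]]] /kO.
  move=> [x y] Oxy.
  have /(prod_dist_topology dtX dtY)[e e0 eO] : nbhs ((x, y) : (X * Y)%type) O.
    exact: open_nbhs_nbhs.
  have e20 : 0 < e / 2 by rewrite divr_gt0.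
  have [k] := ltr_add_invr e20; rewrite add0r => ke.
  have k0 : 0 < k.+1%:R^-1 :> R by rewrite invr_gt0.
  have [i hi] := hx x _ k0; have [j hj] := hy y _ k0.
  have kO : B i j k `<=` O.
    move=> p Bp; have hx' : dX (x_ i) p.1 < k.+1%:R^-1 by case: Bp.
    have hy' : dY (y_ j) p.2 < k.+1%:R^-1 by case: Bp.
    suff : prod_dist dX dY (x, y) p < e by exact: eO.
    rewrite prod_dist_lt; apply/andP; split.
      rewrite (le_lt_trans (dist_tri ddX (x_ i) _ _))// [ltRHS]splitr ltrD//.
        exact: lt_trans hi ke.
      exact: lt_trans hx' ke.
    rewrite (le_lt_trans (dist_tri ddY (y_ j) _ _))// [ltRHS]splitr ltrD//.
      exact: lt_trans hj ke.
    exact: lt_trans hy' ke.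
  have Bxy : B i j k (x, y).
    by split; [rewrite /= (distC ddX)|rewrite /= (distC ddY)].
  by exists i => //; exists j => //; exists k.
apply: bigcupT_measurable => i; apply: bigcupT_measurable => j.
by apply: bigcup_measurable => k _.
Qed.

Lemma borel_prod_id :
  measurable_fun setT (id : (borel X * borel Y)%type -> borel (X * Y)%type).
Proof.
apply: (@measurability _ _ (borel X * borel Y)%type (borel (X * Y)%type) _ _
  (@open (X * Y)%type)) => // _ [A oA <-].
by rewrite setTI; exact: open_prod_measurable.
Qed.

End ProductBorel.

Section ApproximateGluing.
Context {R : realType} {X1 X2 Y : ptopologicalType}.
Hypotheses (p1 : @polish R X1) (p2 : @polish R X2).
Variables (f : X1 -> Y) (g : X2 -> Y) (cf : continuous f) (cg : continuous g).
Variables (pi1 : bprob R X1) (pi2 : bprob R X2).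
Hypothesis fg : push cf pi1 = push cg pi2.
Variable P_ : nat -> set Y.
Hypotheses (mP : forall i, measurable (P_ i : set (borel Y)))
  (tP : trivIset setT P_) (UP : \bigcup_i P_ i = setT).

Let F i := f @^-1` P_ i.
Let G i := g @^-1` P_ i.

Let mF i : measurable (F i : set (borel X1)). Proof. exact: preimage_borel. Qed.
Let mG i : measurable (G i : set (borel X2)). Proof. exact: preimage_borel. Qed.

Let mfst (A : set (borel X1)) : measurable A ->
  measurable (fst @^-1` A : set (borel (X1 * X2)%type)).
Proof. by move=> mA; apply: preimage_borel => //; exact: fst_continuous. Qed.

Let msnd (A : set (borel X2)) : measurable A ->
  measurable (snd @^-1` A : set (borel (X1 * X2)%type)).
Proof. by move=> mA; apply: preimage_borel => //; exact: snd_continuous. Qed.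

Let mR i : measurable (F i `*` G i : set (borel (X1 * X2)%type)).
Proof. by apply: measurableI; [exact: mfst|exact: msnd]. Qed.

Let w i : R := fine (pi1 (F i)).

Let wE i : pi1 (F i) = (w i)%:E.
Proof. by rewrite fineK// fin_num_measure. Qed.

Let wE2 i : pi2 (G i) = (w i)%:E.
Proof.
by rewrite -wE; have := congr1 (fun n : bprob R Y => n (P_ i)) fg; rewrite /= !pushE.
Qed.

Let w0 i : 0 <= (w i)^-1.
Proof. by rewrite invr_ge0 fine_ge0. Qed.

Let Pr (A : set (borel (X1 * X2)%type)) : \bar R := (pi1 \x pi2)%E A.

Let mid (A : set (borel (X1 * X2)%type)) : measurable A ->
  measurable (A : set (borel X1 * borel X2)%type).
Proof.
by move=> mA; have := borel_prod_id p1 p2 measurableT mA; rewrite setTI.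
Qed.

Let Pr0 : Pr set0 = 0%E. Proof. exact: measure0. Qed.

Let Pr_ge0 A : (0 <= Pr A)%E. Proof. exact: measure_ge0. Qed.

Let Pr_sigma_additive : semi_sigma_additive Pr.
Proof.
move=> A mA tA mUA; apply: measure_semi_sigma_additive => //; last exact: mid.
by move=> i; exact: mid.
Qed.

HB.instance Definition _ := isMeasure.Build _ (borel (X1 * X2)%type) R Pr
  Pr0 Pr_ge0 Pr_sigma_additive.

Let PrX (A : set (borel X1)) (B : set (borel X2)) : measurable A -> measurable B ->
  Pr (A `*` B) = (pi1 A * pi2 B)%E.
Proof. by move=> mA mB; rewrite -product_measure1E. Qed.

(** The product measure on one cell, divided by the common mass [w i] so that its marginals are the
    restrictions of [pi1] and [pi2] to the cell. If [w i = 0] the inverse is 0 and the cell is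
    dropped. *)
Let m i : {measure set (borel (X1 * X2)%type) -> \bar R} :=
  mscale (NngNum (w0 i)) (mrestr Pr (mR i)).

Let sig : {measure set (borel (X1 * X2)%type) -> \bar R} := mseries m 0.

Let sigE (B : set (borel (X1 * X2)%type)) :
  sig B = (\sum_(i <oo) ((w i)^-1%:E * Pr (B `&` (F i `*` G i))))%E.
Proof. by []. Qed.

Let sum1 (A : set (borel X1)) : measurable A ->
  (\sum_(i <oo) pi1 (A `&` F i))%E = pi1 A.
Proof.
move=> mA; have mAF i : measurable (A `&` F i) by exact: measurableI.
have UF : \bigcup_i (A `&` F i) = A.
  by rewrite -setI_bigcupr /F -preimage_bigcup UP preimage_setT setIT.
rewrite -[in RHS]UF; apply/cvg_lim => //.
apply: (@measure_semi_sigma_additive _ _ _ pi1 (fun i => A `&` F i)) => //.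
  apply/trivIsetP => i j _ _ ij; apply/seteqP; split=> // x [[_ Fi] [_ Fj]].
  have /trivIsetP/(_ i j Logic.I Logic.I ij)/seteqP[h _] := tP.
  exact: (h (f x)).
by rewrite UF.
Qed.

Let sum2 (A : set (borel X2)) : measurable A ->
  (\sum_(i <oo) pi2 (A `&` G i))%E = pi2 A.
Proof.
move=> mA; have mAF i : measurable (A `&` G i) by exact: measurableI.
have UF : \bigcup_i (A `&` G i) = A.
  by rewrite -setI_bigcupr /G -preimage_bigcup UP preimage_setT setIT.
rewrite -[in RHS]UF; apply/cvg_lim => //.
apply: (@measure_semi_sigma_additive _ _ _ pi2 (fun i => A `&` G i)) => //.
  apply/trivIsetP => i j _ _ ij; apply/seteqP; split=> // x [[_ Fi] [_ Fj]].
  have /trivIsetP/(_ i j Logic.I Logic.I ij)/seteqP[h _] := tP.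
  exact: (h (g x)).
by rewrite UF.
Qed.

Let cancel_w i (a : \bar R) : (0 <= a)%E -> (a <= (w i)%:E)%E ->
  ((w i)^-1%:E * (a * (w i)%:E))%E = a.
Proof.
case: a => [a| |]// a0 aw; rewrite -!EFinM; congr EFin.
(* A cell of mass 0 forces [a = 0], in agreement with the convention [0^-1 = 0]. *)
have [wi0|wi0] := eqVneq (w i) 0; last by rewrite mulrCA mulVf// mulr1.
move: a0 aw; rewrite !lee_fin wi0 => a0 a1.
by rewrite !mulr0; apply/eqP; rewrite eq_le a0 a1.
Qed.

Let sig_fst (A : set (borel X1)) : measurable A -> sig (fst @^-1` A) = pi1 A.
Proof.
move=> mA; rewrite sigE -[RHS]sum1//; apply: eq_eseriesr => i _.
rewrite (_ : _ `&` _ = (A `&` F i) `*` G i); last first.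
  by apply/seteqP; split=> -[x y] /=; [move=> [? []]|move=> [[]]].
rewrite PrX//; last exact: measurableI.
rewrite wE2 cancel_w// -wE; apply: le_measure; rewrite ?inE//.
exact: measurableI.
Qed.

Let sig_snd (A : set (borel X2)) : measurable A -> sig (snd @^-1` A) = pi2 A.
Proof.
move=> mA; rewrite sigE -[RHS]sum2//; apply: eq_eseriesr => i _.
rewrite (_ : _ `&` _ = F i `*` (A `&` G i)); last first.
  by apply/seteqP; split=> -[x y] /=; [move=> [? []]|move=> [? []]].
rewrite PrX//; last exact: measurableI.
rewrite wE [X in (_ * X)%E]muleC cancel_w// -wE2; apply: le_measure; rewrite ?inE//.
exact: measurableI.
Qed.

Let sig_setT : sig setT = 1%E.
Proof.
by rewrite -(@preimage_setT _ _ fst) sig_fst//; exact: (@probability_setT _ _ _ pi1).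
Qed.

HB.instance Definition _ := Measure_isProbability.Build _ (borel (X1 * X2)%type) R
  (mseries m 0) sig_setT.

(** Every summand of [sig] lives on pairs whose images share a cell, so intersecting with [B]
    changes no term of the series. *)
Lemma approximate_gluing : exists s : bprob R (X1 * X2)%type,
  is_coupling pi1 pi2 s /\
  forall B : set (borel (X1 * X2)%type), measurable B ->
    (forall i p, P_ i (f p.1) -> P_ i (g p.2) -> B p) -> s B = 1%E.
Proof.
pose S : probability (borel (X1 * X2)%type) R := mseries m 0.
exists (to_bprob S); split.
  split; apply: bprob_ext => A mA; rewrite pushE// to_bprobE.
  - exact: sig_fst.
  - exact: mfst.
  - exact: sig_snd.
  - exact: msnd.
move=> B mB hB; rewrite to_bprobE//.
rewrite -sig_setT [S B]/(sig B) !sigE; apply: eq_eseriesr => i _.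
congr (_ * Pr _)%E; rewrite setTI; apply/setIidPr => p [Fp Gp]; exact: hB Fp Gp.
Qed.

End ApproximateGluing.

Section DistanceContinuity.
Context {R : realType} {Y : ptopologicalType} (d : Y -> Y -> R).
Hypotheses (dd : is_distance d) (dt : induces_topology d).

Lemma dist2_continuous : continuous (fun y : (Y * Y)%type => d y.1 y.2).
Proof.
apply: (@lip_continuous _ _ _ (prod_dist_distance dd dd) (prod_dist_topology dt dt) _ 2).
move=> [a b] [a' b'] /=.
have ha : d a a' <= prod_dist d d (a, b) (a', b') by rewrite /prod_dist le_max lexx.
have hb : d b b' <= prod_dist d d (a, b) (a', b') by rewrite /prod_dist le_max lexx orbT.
have := dist_tri dd a' a b; have := dist_tri dd b' a' b.
have := dist_tri dd a a' b'; have := dist_tri dd b a b'.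
rewrite (distC dd b' b) (distC dd a' a) ler_norml => *.
by apply/andP; split; lra.
Qed.

End DistanceContinuity.

Section Gluing.
Context {R : realType} {X1 X2 Y : ptopologicalType}.
Hypotheses (p1 : @polish R X1) (p2 : @polish R X2) (pY : @polish R Y).
Variables (f : X1 -> Y) (g : X2 -> Y) (cf : continuous f) (cg : continuous g).
Variables (pi1 : bprob R X1) (pi2 : bprob R X2).
Hypothesis fg : push cf pi1 = push cg pi2.

(* Couplings that are products on the cells of finer and finer partitions of [Y]
   are compact, and their limit is concentrated on [f x = g y]; this replaces
   disintegration. *)
Theorem gluing : exists2 s : bprob R (X1 * X2)%type, is_coupling pi1 pi2 s &
  s.-negligible [set p | f p.1 <> g p.2].
Proof.
have [sY [d [dd dt _]]] := pY.
have [y_ hy] := separable_dense_sequence dd dt sY.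
have [_ [d1 [dd1 dt1 _]]] := p1; have [_ [d2 [dd2 dt2 _]]] := p2.
have ddP := prod_dist_distance dd1 dd2; have dtP := prod_dist_topology dt1 dt2.
(* Two points of one cell lie in a common ball of radius [n.+1%:R^-1], hence the factor 2. *)
pose D n : set (X1 * X2)%type := [set p | d (f p.1) (g p.2) <= 2 * n.+1%:R^-1].
have cD n : closed (D n).
  have cdfg : continuous (fun p : (X1 * X2)%type => d (f p.1) (g p.2)).
    move=> p; apply: (@continuous_comp _ _ _ (fun p : (X1 * X2)%type => (f p.1, g p.2))
      (fun y : (Y * Y)%type => d y.1 y.2)); last exact: (dist2_continuous dd dt).
    have c1 : continuous (f \o fst : (X1 * X2)%type -> Y).
      by move=> r; apply: continuous_comp; [exact: fst_continuous|exact: cf].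
    have c2 : continuous (g \o snd : (X1 * X2)%type -> Y).
      by move=> r; apply: continuous_comp; [exact: snd_continuous|exact: cg].
    by apply: cvg_pair; [exact: (c1 p)|exact: (c2 p)].
  have /continuous_closedP/(_ _ (@closed_le _ (2 * n.+1%:R^-1))) := cdfg.
  exact.
have /choice[s hs] : forall n, exists s : bprob R (X1 * X2)%type,
    is_coupling pi1 pi2 s /\ s (D n) = 1%E.
  move=> n; pose B i : set Y := [set y | d (y_ i) y < n.+1%:R^-1].
  have mB i : measurable (B i : set (borel Y)).
    apply: open_borel.
    by have /continuousP/(_ _ (@open_lt _ n.+1%:R^-1)) := distr_continuous dd dt (x := y_ i).
  have [|||s [hs1 hs2]] := approximate_gluing p1 p2 fg (P_ := seqDU B).
  - move=> i; rewrite /seqDU; apply: measurableD => //.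
    by apply: bigsetU_measurable => j _.
  - exact: trivIset_seqDU.
  - rewrite -seqDU_bigcup_eq; apply/seteqP; split=> // y _.
    have n0 : 0 < n.+1%:R^-1 :> R by rewrite invr_gt0.
    by have [i hi] := hy y _ n0; exists i => //; rewrite /B /= (distC dd).
  exists s; split=> //; apply: hs2; first exact: closed_borel.
  move=> i p /(@subset_seqDU _ B i _) h1 /(@subset_seqDU _ B i _) h2.
  rewrite /D /= (le_trans (dist_tri dd (y_ i) _ _))// (_ : 2 = 1 + 1)// mulrDl mul1r.
  by rewrite lerD//; apply: ltW; rewrite // (distC dd).
have [n|U [sg [PU oU hU hsg]]] := coupling_limit p1 p2 (pi_ := s) (cvg_cst pi1) (cvg_cst pi2).
  by case: (hs n).
exists sg => //.
have mD n : measurable (D n : set (borel (X1 * X2)%type)) by exact: closed_borel.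
have Dnull n : sg.-negligible (~` D n).
  apply/negligibleP; first exact: measurableC.
  suff h : sg (D n) = 1%E.
    by have := @probability_setC _ _ _ sg _ (mD n); rewrite h subee.
  apply/eqP; rewrite eq_le (@probability_le1 _ _ _ sg)//=.
  rewrite -[sg _]fineK ?fin_num_measure// lee_fin.
  apply: (portmanteau_closed ddP dtP PU hU (cD n)).
  (* [D] decreases, so [s m] is concentrated on [D n] for every [m >= n], which is enough along
     [U]. *)
  apply: oU; exists n => // m /= nm.
  have [_ hm] := hs m; rewrite -lee_fin fineK ?fin_num_measure// -hm.
  apply: le_measure; rewrite ?inE// => p; rewrite /D /= => /le_trans; apply.
  by rewrite ler_wpM2l// lef_pV2 ?posrE ?ltr0n// ler_nat.
apply: negligibleS (negligible_bigcup Dnull) => p /= np.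
have d0 : 0 < d (f p.1) (g p.2) / 2.
  rewrite divr_gt0// lt_neqAle (dist_ge0 dd) andbT eq_sym; apply/negP => /eqP.
  by move=> /(dist0_eq dd).
have [n] := ltr_add_invr d0; rewrite add0r => hn.
by exists n => //; apply/negP; rewrite -ltNge mulrC -ltr_pdivlMr.
Qed.

End Gluing.

(** * The utility function *)

Section PowerConcavity.
Context {R : realType}.
Implicit Types q r x y a b : R.

(** Concavity: [r - 1] is the tangent of the left-hand side at 1. With [r = expR v] everything
    reduces to [1 + x <= expR x]. *)
Lemma powR_tangent q r : q != 0 -> q <= 1 -> 0 < r -> (r `^ q - 1) / q <= r - 1.
Proof.
move=> q0 q1 r0; rewrite /powR gt_eqF//; set v := ln r.
have -> : r = expR v by rewrite lnK.
have [q_lt0|q_gt0|/eqP] := ltgtP q 0; last by rewrite (negbTE q0).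
  rewrite ler_ndivrMr//.
  have h1 := expR_ge1Dx (q * v).
  have : expR v * q <= (1 + v) * q by rewrite ler_wnM2r ?expR_ge1Dx// ltW.
  by rewrite mulrDl mul1r; lra.
rewrite ler_pdivrMr//.
have e0 := expR_ge0 (q * v).
(* For [0 < q <= 1] the bounds [h1] and [h2] are averaged with weights [q] and [1 - q]; the terms
   linear in [v] cancel. *)
have h1 : expR (q * v) * (1 + (1 - q) * v) <= expR v.
  have -> : expR v = expR (q * v) * expR ((1 - q) * v).
    by rewrite -expRD; congr expR; lra.
  by rewrite ler_wpM2l// expR_ge1Dx.
have h2 : expR (q * v) * (1 + - (q * v)) <= 1.
  rewrite -[leRHS](expRxMexpNx_1 (q * v)).
  by rewrite ler_wpM2l// expR_ge1Dx.
have h3 := ler_wpM2l (ltW q_gt0) h1.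
have h4 : (1 - q) * (expR (q * v) * (1 + - (q * v))) <= (1 - q) * 1.
  by rewrite ler_wpM2l// subr_ge0.
set E := expR (q * v) in h3 h4 *; set F := expR v in h3 *.
have : q * (E * (1 + (1 - q) * v)) + (1 - q) * (E * (1 + - (q * v))) = E by ring.
lra.
Qed.

Lemma powR_tangent0 q : 0 < q -> q <= 1 -> ((0 : R) `^ q - 1) / q <= 0 - 1.
Proof.
move=> q0 q1; rewrite powR0 ?gt_eqF// !sub0r ler_pdivrMr// mulN1r.
by rewrite lerN2.
Qed.

(* In the variables [x^q / q] and [y^q / q] the right-hand side is convex and
   1-homogeneous; the left-hand side is its supporting plane at [(a, b)]. *)
Lemma powR_superadditive q a b : q != 0 -> q <= 1 -> 0 < a -> 0 < b ->
  exists c1 c2, [/\ 0 < c1, 0 < c2,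
    c1 * (a `^ q / q) + c2 * (b `^ q / q) = (a + b) `^ q / q
  & forall x y, 0 <= x -> 0 <= y -> (0 < q \/ 0 < x /\ 0 < y) ->
    c1 * (x `^ q / q) + c2 * (y `^ q / q) <= (x + y) `^ q / q].
Proof.
move=> q0 q1 a0 b0; have ab0 : 0 < a + b by exact: addr_gt0.
pose A := a / (a + b); pose B := b / (a + b).
have A0 : 0 < A by exact: divr_gt0. have B0 : 0 < B by exact: divr_gt0.
have AB : A + B = 1 by rewrite -mulrDl divff// gt_eqF.
have Ai0 : 0 <= A^-1 by rewrite invr_ge0 ltW. have Bi0 : 0 <= B^-1 by rewrite invr_ge0 ltW.
(* These are [A^(1-q)] and [B^(1-q)], that is, [u'(a + b) / u'(a)] and [u'(a + b) / u'(b)] for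
   [u(x) = x^q / q]: the gradient of the function to be supported. *)
exists (A * (A^-1 `^ q)), (B * (B^-1 `^ q)); split.
- by rewrite mulr_gt0// powR_gt0// invr_gt0.
- by rewrite mulr_gt0// powR_gt0// invr_gt0.
- rewrite !mulrA -(mulrA A) -(mulrA B) -!powRM ?(ltW a0) ?(ltW b0)//.
  have -> : A^-1 * a = a + b by rewrite /A invf_div divfK// gt_eqF.
  have -> : B^-1 * b = a + b by rewrite /B invf_div divfK// gt_eqF.
  have -> : A * (a + b) `^ q / q + B * (a + b) `^ q / q = (A + B) * ((a + b) `^ q / q).
    by ring.
  by rewrite AB mul1r.
move=> x y x0 y0 hq.
have [xy0|] := eqVneq (x + y) 0.
  have x00 : x = 0 by apply/eqP; rewrite eq_le x0 andbT -xy0 lerDl.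
  have y00 : y = 0 by apply/eqP; rewrite eq_le y0 andbT -xy0 lerDr.
  by rewrite x00 y00 addr0 powR0// !mul0r !mulr0 addr0.
move=> xy0; have {}xy0 : 0 < x + y by rewrite lt_neqAle eq_sym xy0 addr_ge0.
pose X := x / (x + y); pose Y := y / (x + y).
have XY : X + Y = 1 by rewrite -mulrDl divff// gt_eqF.
have X0 : 0 <= X by rewrite divr_ge0// ltW. have Y0 : 0 <= Y by rewrite divr_ge0// ltW.
(* After division by [(x + y)^q] the tangent inequality is applied at [X / A] and [Y / B]; the
   right-hand sides add up to [X + Y - (A + B) = 0]. *)
have tan (Z C : R) : 0 <= Z -> 0 < C -> (0 < q \/ 0 < Z) ->
    C * (((Z / C) `^ q - 1) / q) <= Z - C.
  move=> Z0 C0 hZ; have -> : Z - C = C * (Z / C - 1).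
    by rewrite mulrBr mulrCA divff ?gt_eqF// !mulr1.
  rewrite ler_wpM2l ?(ltW C0)//; case: (eqVneq Z 0) hZ => [->|Zn0] hZ.
    by rewrite mul0r; apply: powR_tangent0 => //; case: hZ => //; rewrite ltxx.
  by apply: powR_tangent => //; rewrite divr_gt0// lt_neqAle eq_sym Zn0.
have h1 : A * (((X / A) `^ q - 1) / q) <= X - A.
  by apply: tan => //; case: hq => [|[? _]]; [left|right; exact: divr_gt0].
have h2 : B * (((Y / B) `^ q - 1) / q) <= Y - B.
  by apply: tan => //; case: hq => [|[_ ?]]; [left|right; exact: divr_gt0].
have xE : x = (x + y) * X by rewrite mulrCA divff ?mulr1// gt_eqF.
have yE : y = (x + y) * Y by rewrite mulrCA divff ?mulr1// gt_eqF.
have hx : A * A^-1 `^ q * (x `^ q / q) = (x + y) `^ q * (A * ((X / A) `^ q / q)).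
  rewrite [in x `^ q]xE powRM ?(ltW xy0)// [(X / A) `^ q]powRM//; ring.
have hy : B * B^-1 `^ q * (y `^ q / q) = (x + y) `^ q * (B * ((Y / B) `^ q / q)).
  rewrite [in y `^ q]yE powRM ?(ltW xy0)// [(Y / B) `^ q]powRM//; ring.
rewrite hx hy -mulrDr ler_wpM2l ?powR_ge0//.
move: h1 h2; rewrite !mulrBl !mulrBr mul1r => h1 h2.
have : A * q^-1 + B * q^-1 = q^-1 by rewrite -mulrDl AB mul1r.
lra.
Qed.

End PowerConcavity.

Section Utility.
Context {R : realType} (q : R).
Hypotheses (q0 : q != 0) (q1 : q <= 1).
Local Open Scope ereal_scope.

Lemma utility_ge0E (r : R) : (0 <= r)%R -> (0 < q \/ 0 < r)%R ->
  utility q r%:E = (r `^ q / q)%:E.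
Proof.
rewrite le_eqVlt => /predU1P[<-|r0]; last by rewrite /= r0.
by case=> [q_gt0|]; [|by rewrite ltxx]; rewrite /= ltxx eqxx q_gt0 powR0// mul0r.
Qed.

Lemma utility_ge0 z : (0 < q)%R -> 0 <= z -> 0 <= utility q z.
Proof.
move=> q_gt0; case: z => [r| |]//; last by rewrite /= q_gt0 leey.
rewrite lee_fin => r0; rewrite utility_ge0E//; last by left.
by rewrite lee_fin divr_ge0 ?powR_ge0// ltW.
Qed.

Lemma utility_le0 z : (q < 0)%R -> utility q z <= 0.
Proof.
move=> q_lt0; have nq : (0 < q)%R = false by rewrite ltNge ltW.
case: z => [r| |]//=; last by rewrite nq.
rewrite nq; case: ifP => [r0|_]; last by case: ifP.
by rewrite lee_fin mulr_ge0_le0 ?powR_ge0// invr_le0 ltW.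
Qed.

Lemma le_utility y z : y <= z -> utility q y <= utility q z.
Proof.
have mono (r s : R) : (0 < r)%R -> (r <= s)%R -> (r `^ q / q <= s `^ q / q)%R.
  move=> r0 rs; have s0 : (0 < s)%R by exact: lt_le_trans rs.
  have lrs : (ln r <= ln s)%R by rewrite ler_ln.
  rewrite /powR !gt_eqF//; have [q_lt0|q_gt0|/eqP] := ltgtP q 0%R; last by rewrite (negbTE q0).
    by rewrite ler_nM2r ?invr_lt0// ler_expR ler_nM2l.
  by rewrite ler_pM2r ?invr_gt0// ler_expR ler_pM2l.
case: z => [s| |]; last by rewrite leeNy_eq => /eqP ->.
  case: y => [r| |]//; rewrite ?leNye// lee_fin => rs.
  have [r0|r0|r0] := ltgtP r 0%R.
  - by rewrite /= ltNge (ltW r0)/= lt_eqF// leNye.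
  - by rewrite /= r0 (lt_le_trans r0 rs) lee_fin mono.
  have [q_lt0|q_gt0|/eqP] := ltgtP q 0%R; last by rewrite (negbTE q0).
    by rewrite r0 /= ltxx eqxx ltNge (ltW q_lt0)/= leNye.
  rewrite r0 in rs *; rewrite [leLHS]/= ltxx eqxx q_gt0.
  by apply: utility_ge0; rewrite ?lee_fin.
move=> _; have [q_lt0|q_gt0|/eqP] := ltgtP q 0%R; last by rewrite (negbTE q0).
  by rewrite [leRHS]/= ltNge (ltW q_lt0)/=; exact: utility_le0.
by rewrite [leRHS]/= q_gt0 leey.
Qed.

Lemma utility_superadditive (a b : R) : (0 < a)%R -> (0 < b)%R ->
  exists c1 c2 : R, [/\ (0 < c1)%R, (0 < c2)%R,
    c1%:E * utility q a%:E + c2%:E * utility q b%:E = utility q (a + b)%:E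
  & forall y z, 0 <= y -> 0 <= z ->
    c1%:E * utility q y + c2%:E * utility q z <= utility q (y + z)].
Proof.
move=> a0 b0; have [c1 [c2 [c10 c20 cE h]]] := powR_superadditive q0 q1 a0 b0.
exists c1, c2; split=> //.
  by rewrite /= a0 b0 addr_gt0// -!EFinM -EFinD cE.
have [q_lt0|q_gt0|/eqP] := ltgtP q 0%R; last by rewrite (negbTE q0).
  have nq : (0 < q)%R = false by rewrite ltNge ltW.
  have cu c y : (0 < c)%R -> c%:E * utility q y <= 0.
    by move=> c0; rewrite mule_ge0_le0 ?utility_le0// lee_fin ltW.
  have uy : utility q +oo = 0 by rewrite /= nq.
  move=> [y| |] // [z| |] //; last 3 first.
  - by move=> _ _; rewrite addey// [leRHS]uy adde_le0// cu.
  - by move=> _ _; rewrite addye// [leRHS]uy adde_le0// cu.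
  - by move=> _ _; rewrite addye// [leRHS]uy adde_le0// cu.
  rewrite !lee_fin le_eqVlt => /predU1P[<- _|y0].
    have -> : utility q 0%:E = -oo by rewrite /= ltxx eqxx nq.
    by rewrite gt0_muleNy ?lte_fin// addNye leNye.
  rewrite le_eqVlt => /predU1P[<-|z0].
    have -> : utility q 0%:E = -oo by rewrite /= ltxx eqxx nq.
    by rewrite gt0_muleNy ?lte_fin// addeNy leNye.
  rewrite /= y0 z0 addr_gt0// -!EFinM -EFinD lee_fin.
  by apply: h; rewrite ?ltW//; right.
have uy : utility q +oo = +oo by rewrite /= q_gt0.
move=> [y| |] // [z| |] //; last 3 first.
- by move=> _ _; rewrite addey// uy leey.
- by move=> _ _; rewrite addye// uy leey.
- by move=> _ _; rewrite addye// uy leey.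
rewrite !lee_fin => y0 z0; rewrite -EFinD !utility_ge0E//; try by left.
  by rewrite -!EFinM -EFinD lee_fin; apply: h => //; left.
exact: addr_ge0.
Qed.

Lemma measurable_utility : measurable_fun [set: \bar R] (utility q).
Proof.
pose g (z : \bar R) := if z == +oo then (if (0 < q)%R then +oo else 0) else
  if 0 < z then (fine z `^ q / q)%:E else
  if z == 0 then (if (0 < q)%R then 0 else -oo) else -oo.
rewrite (_ : utility q = g); last first.
  by apply/funext => -[r| |]; rewrite /g ?eqxx//=.
apply: measurable_fun_ifT => //.
  by apply: measurable_fun_eqe.
apply: measurable_fun_ifT => //.
- exact: measurable_fun_lte.
- apply/measurable_EFinP; apply: measurable_funM => //.
  apply: (measurableT_comp (measurable_powR q)); exact: fine_measurable.
apply: measurable_fun_ifT => //.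
exact: measurable_fun_eqe.
Qed.

End Utility.

(** * Integrating linear inequalities between functions of constant sign *)

Section IntegralMix.
Context {dsp : measure_display} {T : measurableType dsp} {R : realType}.
Variables (P : {measure set T -> \bar R}) (c1 c2 : R) (f1 f2 f3 : T -> \bar R).
Hypotheses (c10 : 0 <= c1) (c20 : 0 <= c2).
Hypotheses (mf1 : measurable_fun setT f1) (mf2 : measurable_fun setT f2)
  (mf3 : measurable_fun setT f3).
Local Open Scope ereal_scope.

Lemma ge0_integral_mix : (forall x, 0 <= f1 x) -> (forall x, 0 <= f2 x) ->
  \int[P]_x (c1%:E * f1 x + c2%:E * f2 x) =
  c1%:E * \int[P]_x f1 x + c2%:E * \int[P]_x f2 x.
Proof.
move=> h1 h2; rewrite ge0_integralD//.
- by rewrite !ge0_integralZl_EFin.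
- by move=> x _; rewrite mule_ge0.
- exact: measurable_funeM.
- by move=> x _; rewrite mule_ge0.
- exact: measurable_funeM.
Qed.

Lemma ge0_le_integral_mix : (forall x, 0 <= f1 x) -> (forall x, 0 <= f2 x) ->
  (forall x, 0 <= f3 x) ->
  {ae P, forall x, c1%:E * f1 x + c2%:E * f2 x <= f3 x} ->
  c1%:E * \int[P]_x f1 x + c2%:E * \int[P]_x f2 x <= \int[P]_x f3 x.
Proof.
move=> h1 h2 h3 hae; rewrite -ge0_integral_mix//.
apply: ae_ge0_le_integral => //.
- by move=> x _; rewrite adde_ge0// mule_ge0.
- by apply: emeasurable_funD; exact: measurable_funeM.
- by apply: filterS hae => x + _.
Qed.

Lemma ge0_ge_integral_mix : (forall x, 0 <= f1 x) -> (forall x, 0 <= f2 x) ->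
  (forall x, 0 <= f3 x) ->
  {ae P, forall x, f3 x <= c1%:E * f1 x + c2%:E * f2 x} ->
  \int[P]_x f3 x <= c1%:E * \int[P]_x f1 x + c2%:E * \int[P]_x f2 x.
Proof.
move=> h1 h2 h3 hae; rewrite -ge0_integral_mix//.
apply: ae_ge0_le_integral => //.
- by move=> x _; rewrite adde_ge0// mule_ge0.
- by apply: emeasurable_funD; exact: measurable_funeM.
- by apply: filterS hae => x + _.
Qed.

End IntegralMix.

Lemma le_mixN (R : realType) (c1 c2 : R) (x y z : \bar R) :
  0 <= c1 -> 0 <= c2 -> (0 <= x)%E -> (0 <= y)%E ->
  (c1%:E * - x + c2%:E * - y <= - z)%E = (z <= c1%:E * x + c2%:E * y)%E.
Proof.
move=> c10 c20 x0 y0; rewrite !muleN -oppeD ?leeN2//.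
by apply: ge0_adde_def; rewrite inE mule_ge0// lee_fin.
Qed.

(** Constant sign replaces integrability: linearity and monotonicity then hold for infinite
    integrals too. The nonpositive case is the nonnegative one after negation, with the inequality
    reversed. *)
Lemma le_integral_mix (dsp : measure_display) (T : measurableType dsp) (R : realType)
    (P : {measure set T -> \bar R}) (c1 c2 : R) (f1 f2 f3 : T -> \bar R) :
  0 <= c1 -> 0 <= c2 -> measurable_fun setT f1 -> measurable_fun setT f2 ->
  measurable_fun setT f3 ->
  ((forall x, 0 <= f1 x) /\ (forall x, 0 <= f2 x) /\ (forall x, 0 <= f3 x) \/
   (forall x, f1 x <= 0) /\ (forall x, f2 x <= 0) /\ (forall x, f3 x <= 0))%E ->
  {ae P, forall x, (c1%:E * f1 x + c2%:E * f2 x <= f3 x)%E} ->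
  (c1%:E * \int[P]_x f1 x + c2%:E * \int[P]_x f2 x <= \int[P]_x f3 x)%E.
Proof.
move=> c10 c20 m1 m2 m3 [[h1 [h2 h3]]|[h1 [h2 h3]]] hae.
  exact: ge0_le_integral_mix.
have N (f : T -> \bar R) : (forall x, (f x <= 0)%E) ->
    (\int[P]_x f x = - \int[P]_x (- f x))%E.
  move=> f0; rewrite -integral_ge0N//; last by move=> x _; rewrite oppe_ge0.
  by apply: eq_integral => x _; rewrite oppeK.
rewrite (N f1)// (N f2)// (N f3)// le_mixN//; last 2 first.
- by apply: integral_ge0 => x _; rewrite oppe_ge0.
- by apply: integral_ge0 => x _; rewrite oppe_ge0.
apply: ge0_ge_integral_mix => //; try (by apply: measurableT_comp);
  try (by move=> x; rewrite oppe_ge0).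
apply: filterS hae => x; rewrite -{1}[f1 x]oppeK -{1}[f2 x]oppeK -{1}[f3 x]oppeK.
by rewrite le_mixN// oppe_ge0.
Qed.

(** * The Lorentz-Wasserstein time separation *)

Section Transport.
Context {R : realType} {M : ptopologicalType} (l : M -> M -> \bar R) (q : R).
Hypotheses (pM : @polish R M) (tl : time_separation l).
Hypothesis pl : partial_order (causal l).
Hypothesis cl : closed (causal_set l).
Hypothesis bl : borel_separation l.
Hypotheses (q0 : q != 0) (q1 : q <= 1).
Local Open Scope ereal_scope.

Let lp (p : M * M) : \bar R := l p.1 p.2.

(* Truncation makes the integrand of constant sign everywhere, and it does not
   change integrals against causal couplings. *)
Let v (z : \bar R) : \bar R := utility q (maxe 0 z).

Let vE z : 0 <= z -> v z = utility q z.
Proof. by move=> z0; rewrite /v max_r. Qed.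

Let mv : measurable_fun [set: \bar R] v.
Proof.
apply: measurableT_comp; first exact: measurable_utility.
exact: measurable_maxe.
Qed.

Let mul : measurable_fun setT (fun p : borel (M * M)%type => utility q (l p.1 p.2)).
Proof. exact: (measurableT_comp (measurable_utility q) bl). Qed.

Let v_sign : (forall z, 0 <= v z) \/ (forall z, v z <= 0).
Proof.
have [q_lt0|q_gt0|/eqP] := ltgtP q 0%R; last by rewrite (negbTE q0).
  by right => z; exact: utility_le0.
by left => z; apply: utility_ge0 => //; rewrite le_max lexx.
Qed.

Let causal_null mu nu pi : causal_coupling l mu nu pi ->
  pi.-negligible (~` causal_set l).
Proof.
have mC : measurable (causal_set l : set (borel (M * M)%type)) by exact: closed_borel.
move=> [_ h]; apply/negligibleP; first exact: measurableC.
by have := @probability_setC _ _ _ pi _ mC; rewrite h subee.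
Qed.

Let I (pi : bprob R (M * M)%type) : \bar R :=
  \int[pi]_(p in [set: borel (M * M)%type]) utility q (l p.1 p.2).

Let IE mu nu pi : causal_coupling l mu nu pi -> I pi = \int[pi]_p v (lp p).
Proof.
move=> h; apply: ae_eq_integral => //.
- exact: (measurableT_comp mv bl).
apply: negligibleS (causal_null h) => p np cp; apply: np => _ /=.
by rewrite /lp vE.
Qed.

Let T mu nu := transport_value l q mu nu.

Let le_T mu nu pi : causal_coupling l mu nu pi -> I pi <= T mu nu.
Proof. by move=> h; apply: ereal_sup_ubound; exists pi. Qed.

Let T_sign mu nu : causal_coupling l mu nu !=set0 ->
  if (0 < q)%R then 0 <= T mu nu else T mu nu <= 0.
Proof.
move=> [pi hpi]; have [q_gt0|q_le0] := ltP 0%R q.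
  apply: le_trans (le_T hpi); rewrite (IE hpi); apply: integral_ge0 => p _.
  by apply: utility_ge0 => //; rewrite le_max lexx.
apply: ge_ereal_sup => _ [pi' hpi' <-]; rewrite -/(I pi') (IE hpi').
have q_lt0 : (q < 0)%R by rewrite lt_neqAle q0.
have := @integral_ge0 _ _ _ pi' setT (fun p => - v (lp p)).
rewrite (_ : \int[pi']_p v (lp p) = - \int[pi']_p - v (lp p)).
  move=> h; rewrite oppe_le0; apply: h => p _.
  by rewrite oppe_ge0; exact: utility_le0.
rewrite -integral_ge0N; last by move=> p _; rewrite oppe_ge0; exact: utility_le0.
by apply: eq_integral => p _; rewrite oppeK.
Qed.

Lemma ellNy mu nu : causal_coupling l mu nu = set0 -> ell l q mu nu = -oo.
Proof. by move=> h; rewrite /ell asboolT. Qed.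

Lemma ellP mu nu : causal_coupling l mu nu !=set0 ->
  0 <= ell l q mu nu /\ utility q (ell l q mu nu) = T mu nu.
Proof.
move=> h; rewrite /ell asboolF; last by move/eqP; apply/negP/set0P.
have [t ht] := utility_onto q0 (T_sign h).
by have := @xgetPex _ -oo [set t | 0 <= t /\ utility q t = T mu nu] (ex_intro _ t ht).
Qed.

Lemma ell_ge0P mu nu : 0 <= ell l q mu nu <-> causal_coupling l mu nu !=set0.
Proof.
split=> [|/ellP[]//]; have [/ellNy ->//|/set0P] := eqVneq (causal_coupling l mu nu) set0.
by [].
Qed.

(** Every causal coupling of [mu] with itself lives on the diagonal, where [l] vanishes, so all
    admissible integrals equal [utility q 0], which is [-oo] for [q < 0]. *)
Lemma ell_diag mu : ell l q mu mu = 0.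
Proof.
have hd := causal_coupling_diag pl cl mu.
have ne : causal_coupling l mu mu !=set0 by eexists; exact: hd.
have [e0 eT] := ellP ne.
have h pi : causal_coupling l mu mu pi -> I pi = utility q 0.
  move=> hpi; have := causal_coupling_diagonal cl hpi pM pl (fun _ _ _ => erefl).
  move=> dpi; have -> : I pi = \int[pi]_(p in [set: borel (M * M)%type]) cst (utility q 0) p.
    apply: ae_eq_integral => //.
    apply: negligibleS dpi => p np /= ep; apply: np => _ /=.
    by have [_ l0 _] := tl; rewrite ep l0.
  rewrite integral_cst//.
  by rewrite [X in _ * X](@probability_setT _ _ _ pi) mule1.
apply: (utility_inj q0) => //; rewrite eT; apply/eqP; rewrite eq_le; apply/andP; split.
  by apply: ge_ereal_sup => _ [pi hpi <-]; rewrite -/(I pi) h.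
by rewrite -(h _ hd); exact: le_T.
Qed.

Let outer (p : (M * M) * (M * M)) : (M * M)%type := (p.1.1, p.2.2).

Let outer_continuous : continuous (outer : ((M * M) * (M * M))%type -> (M * M)%type).
Proof.
move=> p.
have c1 : continuous ((fst \o fst) : ((M * M) * (M * M))%type -> M).
  by move=> r; apply: continuous_comp; exact: fst_continuous.
have c2 : continuous ((snd \o snd) : ((M * M) * (M * M))%type -> M).
  by move=> r; apply: continuous_comp; exact: snd_continuous.
by apply: cvg_pair; [exact: (c1 p)|exact: (c2 p)].
Qed.

Let lD x y z : causal l x y -> causal l y z -> l x y + l y z <= l x z.
Proof.
have [_ _ h] := tl; move=> xy yz; have := h x y z.
have aE a b : 0 <= a -> 0 <= b -> absorb_add a b = a + b.
  by case: a => [a| |]//; case: b => [b| |].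
by rewrite !aE// [l y z + _]addeC minxx.
Qed.

(** The couplings are glued over [nu] and the outer coordinates kept. The coefficients stay free
    because both the supporting plane and the pairs [(1, 0)] and [(0, 1)], for which [hu] is mere
    monotonicity, are used. *)
Let compose mu nu rho pi1 pi2 (c1 c2 : R) :
  causal_coupling l mu nu pi1 -> causal_coupling l nu rho pi2 ->
  (0 <= c1)%R -> (0 <= c2)%R ->
  (forall y z, 0 <= y -> 0 <= z ->
    c1%:E * utility q y + c2%:E * utility q z <= utility q (y + z)) ->
  exists2 pi3, causal_coupling l mu rho pi3 & c1%:E * I pi1 + c2%:E * I pi2 <= I pi3.
Proof.
move=> h1 h2 c10 c20 hu.
have pMM := polish_prod pM pM.
have /causal_couplingP[[a1 b1] C1] := h1; have /causal_couplingP[[a2 b2] C2] := h2.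
have e12 : push (@snd_continuous M M) pi1 = push (@fst_continuous M M) pi2.
  by rewrite b1 a2.
have [s [s1 s2] sN] := gluing pMM pMM pM e12.
have mC : measurable (causal_set l : set (borel (M * M)%type)) by exact: closed_borel.
have N1 : s.-negligible (fst @^-1` (~` causal_set l)).
  apply/negligibleP; first by apply: preimage_borel; [exact: fst_continuous|exact: measurableC].
  have : pi1 (~` causal_set l) = 0.
    by apply: measure_negligible (causal_null h1); exact: measurableC.
  by rewrite -s1 pushE//; exact: measurableC.
have N2 : s.-negligible (snd @^-1` (~` causal_set l)).
  apply/negligibleP; first by apply: preimage_borel; [exact: snd_continuous|exact: measurableC].
  have : pi2 (~` causal_set l) = 0.
    by apply: measure_negligible (causal_null h2); exact: measurableC.
  by rewrite -s2 pushE//; exact: measurableC.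
have NN := negligibleU (negligibleU N1 N2) sN.
have causal3 p : ~ (fst @^-1` (~` causal_set l) `|` snd @^-1` (~` causal_set l) `|`
    [set p | p.1.2 <> p.2.1]) p ->
  [/\ causal l p.1.1 p.1.2, causal l p.2.1 p.2.2 & p.1.2 = p.2.1].
  move=> np; split; apply: contrapT => h; apply: np; [left; left|left; right|right]; exact: h.
pose pi3 := push outer_continuous s.
have h3 : causal_coupling l mu rho pi3.
  apply/causal_couplingP; split.
    split.
      rewrite -a1 -s1; apply: bprob_ext => A mA; rewrite !pushE//.
        by apply: preimage_borel => //; exact: fst_continuous.
      by apply: preimage_borel => //; exact: fst_continuous.
    rewrite -b2 -s2; apply: bprob_ext => A mA; rewrite !pushE//.
      by apply: preimage_borel => //; exact: snd_continuous.
    by apply: preimage_borel => //; exact: snd_continuous.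
  have m3 : measurable (outer @^-1` causal_set l : set (borel ((M * M) * (M * M))%type)).
    exact: preimage_borel.
  rewrite pushE//.
  have n3 : s (~` (outer @^-1` causal_set l)) = 0.
    apply: measure_negligible; first exact: measurableC.
    apply: negligibleS NN => p np; apply: contrapT => /causal3[x1 x2 x3]; apply: np.
    have [_ tr _] := pl; apply: tr x1 _; by rewrite x3.
  have := @probability_setC _ _ _ s _ (measurableC m3).
  by rewrite setCK n3 sube0.
exists pi3 => //; rewrite (IE h1) (IE h2) (IE h3).
have mvl : measurable_fun setT (fun p : borel (M * M)%type => v (lp p)).
  exact: measurableT_comp mv bl.
rewrite -{1}s1 -{1}s2 !integral_push//.
apply: le_integral_mix => //.
- exact: measurableT_comp mvl (continuous_borel (@fst_continuous _ _)).
- exact: measurableT_comp mvl (continuous_borel (@snd_continuous _ _)).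
- exact: measurableT_comp mvl (continuous_borel outer_continuous).
- by have [vs|vs] := v_sign; [left|right].
apply: negligibleS NN => p np; apply: contrapT => /causal3[x1 x2 x3]; apply: np.
rewrite /= /lp /= !vE//; last by have [_ tr _] := pl; apply: tr x1 _; rewrite x3.
apply: (le_trans (hu _ _ x1 x2)); apply: le_utility => //.
by rewrite x3; apply: lD; rewrite -?x3 //; rewrite x3.
Qed.

Let T_ge mu nu rho pi1 pi2 (c1 c2 : R) :
  causal_coupling l mu nu pi1 -> causal_coupling l nu rho pi2 ->
  (0 <= c1)%R -> (0 <= c2)%R ->
  (forall y z, 0 <= y -> 0 <= z ->
    c1%:E * utility q y + c2%:E * utility q z <= utility q (y + z)) ->
  c1%:E * I pi1 + c2%:E * I pi2 <= T mu rho.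
Proof.
move=> h1 h2 c10 c20 hu; have [pi3 h3 /le_trans] := compose h1 h2 c10 c20 hu.
by apply; exact: le_T.
Qed.

Let utility_le_inv y z : 0 <= y -> 0 <= z -> utility q y <= utility q z -> y <= z.
Proof.
move=> y0 z0 yz; rewrite leNgt; apply/negP => zy.
have /(utility_inj q0 z0 y0) e : utility q z = utility q y.
  by apply/eqP; rewrite eq_le yz le_utility// ltW.
by rewrite e ltxx in zy.
Qed.

Lemma ell_triangle mu nu rho : causal_coupling l mu nu !=set0 ->
  causal_coupling l nu rho !=set0 ->
  ell l q mu nu + ell l q nu rho <= ell l q mu rho.
Proof.
move=> ne1 ne2; have [pi1 h1] := ne1; have [pi2 h2] := ne2.
have ne3 : causal_coupling l mu rho !=set0.
  (* Only the existence of a composed coupling is wanted here, so the trivial coefficients [(1, 0)]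
     do. *)
  have [|pi3 h3 _] := compose (c1 := 1%R) (c2 := 0%R) h1 h2 ler01 (lexx _).
    by move=> y z y0 z0; rewrite mul1e mul0e adde0 le_utility// leeDl.
  by exists pi3.
have [a0 aT] := ellP ne1; have [b0 bT] := ellP ne2; have [c0 cT] := ellP ne3.
apply: utility_le_inv => //; first exact: adde_ge0.
rewrite cT.
(* [ge1] and [ge2] settle the cases where a separation is 0 or [+oo]: the sum is then one of the two
   separations. *)
have ge1 : utility q (ell l q mu nu) <= T mu rho.
  rewrite aT; apply: ge_ereal_sup => _ [pi hpi <-].
  have := T_ge (c1 := 1%R) (c2 := 0%R) hpi h2 ler01 (lexx _).
  rewrite mul1e mul0e adde0; apply => y z y0 z0.
  by rewrite mul1e mul0e adde0 le_utility// leeDl.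
have ge2 : utility q (ell l q nu rho) <= T mu rho.
  rewrite bT; apply: ge_ereal_sup => _ [pi hpi <-].
  have := T_ge (c1 := 0%R) (c2 := 1%R) h1 hpi (lexx _) ler01.
  rewrite mul1e mul0e add0e; apply => y z y0 z0.
  by rewrite mul1e mul0e add0e le_utility// leeDr.
move: (ell l q mu nu) (ell l q nu rho) a0 b0 aT bT ge1 ge2.
move=> [a| |]// [b| |]// a0 b0 aT bT ge1 ge2.
move: a0; rewrite lee_fin le_eqVlt => /predU1P[a0|a0].
  by rewrite -a0 add0e.
move: b0; rewrite lee_fin le_eqVlt => /predU1P[b0|b0].
  by rewrite -b0 adde0.
have [k1 [k2 [k10 k20 kE ku]]] := utility_superadditive q0 q1 a0 b0.
(* Both separations are now positive and finite, so both suprema are finite and can be approached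
   within [e / (k1 + k2)]; weighted by [k1] and [k2], the losses add up to [e]. *)
rewrite -EFinD -kE; apply/lee_addgt0Pr => e e0.
have k0 : (0 < k1 + k2)%R by exact: addr_gt0.
have d0 : (0 < e / (k1 + k2))%R by exact: divr_gt0.
have ua : utility q a%:E = (a `^ q / q)%:E by rewrite /= a0.
have ub : utility q b%:E = (b `^ q / q)%:E by rewrite /= b0.
have fa : T mu nu \is a fin_num by rewrite -aT ua.
have fb : T nu rho \is a fin_num by rewrite -bT ub.
have [_ [p1 hp1 <-] hI1] := ub_ereal_sup_adherent d0 fa.
have [_ [p2 hp2 <-] hI2] := ub_ereal_sup_adherent d0 fb.
have h := T_ge hp1 hp2 (ltW k10) (ltW k20) ku.
rewrite -/(T _ _) -/(I _) in hI1 hI2.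
apply: (@le_trans _ _ (k1%:E * I p1 + k2%:E * I p2 + e%:E)); last by rewrite leeD2r.
have fin T' (i : \bar R) (t d : R) : T' = t%:E -> T' - d%:E < i -> i <= T' ->
    exists2 r, i = r%:E & (t - d <= r)%R.
  move=> ->; case: i => [r| |]//; rewrite -EFinB lte_fin => h' _.
  by exists r => //; exact: ltW.
have [r1 -> hr1] := fin _ (I p1) _ _ (etrans (esym aT) ua) hI1 (le_T hp1).
have [r2 -> hr2] := fin _ (I p2) _ _ (etrans (esym bT) ub) hI2 (le_T hp2).
rewrite ua ub -!EFinM -!EFinD lee_fin.
have eE : e = (k1 * (e / (k1 + k2)) + k2 * (e / (k1 + k2)))%R.
  by rewrite -mulrDl mulrC divfK// gt_eqF.
rewrite [X in (_ <= _ + X)%R]eE.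
have := ler_wpM2l (ltW k10) hr1; have := ler_wpM2l (ltW k20) hr2.
by rewrite !mulrBr; lra.
Qed.

End Transport.

(** * The spacetime of probability measures *)

Theorem proposition2p16 (R : realType) (M : ptopologicalType)
    (l : M -> M -> \bar R) (q : R)
    (M_spacetime : polish_metric_spacetime l)
    (l_borel : borel_separation l)
    (q_neq0 : q != 0) (q_le1 : q <= 1) :
  @polish_metric_spacetime R (bprob R M) (ell l q).
Proof.
have [pM tl pl cl] := M_spacetime.
have tri := ell_triangle pM tl pl cl l_borel q_neq0 q_le1.
have diag := ell_diag pM tl pl cl l_borel q_neq0.
have eP := ell_ge0P cl l_borel q_neq0.
have trans mu nu rho : (0 <= ell l q mu nu -> 0 <= ell l q nu rho -> 0 <= ell l q mu rho)%E.
  move=> h1 h2; apply: le_trans (tri mu nu rho _ _); [exact: adde_ge0|exact/eP|exact/eP].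
split; first exact: polish_bprob.
- split=> //.
    move=> mu nu; have [h|/set0P h] := eqVneq (causal_coupling l mu nu) set0.
      by left; exact: ellNy.
    by right; exact/eP.
  move=> mu nu rho.
  (* A separation equal to [-oo] absorbs the sum that it leads, and this sum decides the minimum. *)
  have [h1|/set0P h1] := eqVneq (causal_coupling l mu nu) set0.
    by rewrite (ellNy q h1)/= ge_min leNye.
  have [h2|/set0P h2] := eqVneq (causal_coupling l nu rho) set0.
    by rewrite (ellNy q h2)/= ge_min leNye orbT.
  have aE (a b : \bar R) : (0 <= a -> 0 <= b -> absorb_add a b = a + b)%E.
    by case: a => [a| |]//; case: b => [b| |].
  by rewrite !aE ?[(ell l q nu rho + _)%E]addeC ?minxx ?tri//; exact/eP.
- split.
  + by move=> mu; rewrite /causal diag.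
  + exact: trans.
  + move=> mu nu /eP[pi h] /eP[pi' h'].
    exact: causal_coupling_antisym h h'.
rewrite (_ : causal_set _ = [set p : bprob R M * bprob R M | causal_coupling l p.1 p.2 !=set0]).
  exact: closed_causal_coupling.
by apply/seteqP; split=> -[mu nu] /= h; exact/eP.
Qed.
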